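(* Any decomposable $2$-step nilpotent real Lie algebra of dimension seven has a coclosed $\mathrm{G}_2$-structure inducing a nilsoliton.
   Context: A Lie algebra is decomposable if it is the direct sum of two (non-zero) ideals. It is $2$-step nilpotent if it is non-abelian and $[\mathfrak{g},[\mathfrak{g},\mathfrak{g}]]=0$. $d$ denotes the Chevalley–Eilenberg differential and $e^{ijk}=e^i\wedge e^j\wedge e^k$, etc. A $\mathrm{G}_2$-structure on a $7$-dimensional real Lie algebra $\mathfrak{g}$ is a positive $3$-form $\varphi\in\Lambda^3(\mathfrak{g}^* )$, i.e. one for which there is a coframe $\{e^1,\dots,e^7\}$ of $\mathfrak{g}^*$ with $\varphi=e^{127}+e^{347}+e^{567}+e^{135}-e^{146}-e^{236}-e^{245}$. It determines (induces) the inner product $g_\varphi=\sum_i(e^i)^2$ and the orientation $e^{1\cdots7}$, and its Hodge dual is $\phi=\star_\varphi\varphi=e^{1234}+e^{1256}+e^{1367}+e^{1457}+e^{2357}-e^{2467}+e^{3456}$. It is coclosed if $d\phi=0$. An inner product $g$ on a nilpotent Lie algebra $\mathfrak{n}$ is a nilsoliton if there are $\lambda\in\mathbb{R}$ and a derivation $D$ of $\mathfrak{n}$ with $Ric(g)=\lambda I+D$, where $Ric(g)$ is the Ricci endomorphism of the corresponding left-invariant metric on the simply connected Lie group with Lie algebra $\mathfrak{n}$. A $\mathrm{G}_2$-structure $\varphi$ induces a nilsoliton if $g_\varphi$ is a nilsoliton. *)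

(* Defs.v *)
From HB Require Import structures.
From mathcomp Require Import all_boot all_order all_algebra.
From mathcomp Require Import reals.

Set Implicit Arguments.
Unset Strict Implicit.
Unset Printing Implicit Defensive.

Import Order.TTheory GRing.Theory Num.Theory.
Local Open Scope ring_scope.

Record lieAlgebra (R : realType) := LieAlgebra {
  lie_space :> vectType R;
  lie : {bilinear lie_space -> lie_space -> lie_space};
  lie_alt : forall x, lie x x = 0;
  lie_jacobi : forall x y z,
    lie x (lie y z) + lie y (lie z x) + lie z (lie x y) = 0
}.

Section LieAlgebras.
Context (R : realType) (g : lieAlgebra R).
Local Notation "[| x , y |]" := (@lie R g x y).

Definition lie_ideal (I : {vspace g}) : Prop :=
  forall x y : g, y \in I -> [| x, y |] \in I.

Definition decomposable : Prop :=
  exists I J : {vspace g},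
    [/\ lie_ideal I /\ lie_ideal J, I != 0%VS /\ J != 0%VS,
        (I + J)%VS = fullv & directv (I + J)].

Definition lie_abelian : Prop := forall x y : g, [| x, y |] = 0.

Definition two_step_nilpotent : Prop :=
  ~ lie_abelian /\ forall x y z : g, [| x, [| y, z |] |] = 0.

Definition lie_derivation (D : 'End(g)) : Prop :=
  forall x y : g, D [| x, y |] = [| D x, y |] + [| x, D y |].

(* Exterior forms are functions of k vectors; membership in the k-th exterior
   power of the dual space is the predicate [altform]. *)
Definition kform (k : nat) := {ffun 'I_k -> g} -> R.

Definition upd k (X : {ffun 'I_k -> g}) (i : 'I_k) (v : g) : {ffun 'I_k -> g} :=
  [ffun j => if j == i then v else X j].

Definition altform k (alpha : kform k) : Prop :=
  (forall (X : {ffun 'I_k -> g}) (i : 'I_k) (a : R) (u v : g),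
      alpha (upd X i (a *: u + v)) =
      a * alpha (upd X i u) + alpha (upd X i v)) /\
  (forall (X : {ffun 'I_k -> g}) (i j : 'I_k),
      i != j -> X i = X j -> alpha X = 0).

(* For i < j, the k vectors [X_i, X_j], X_0, .., X_k with X_i and X_j omitted;
   p |-> bump i (bump j.-1 p) enumerates increasingly the indices other than
   i and j. *)
Definition CE_arg k (X : {ffun 'I_k.+1 -> g}) (i j : 'I_k.+1) :
    {ffun 'I_k -> g} :=
  [ffun p : 'I_k => if p == 0%N :> nat then [| X i, X j |]
                    else X (inord (bump i (bump j.-1 p.-1)))].

(* Chevalley-Eilenberg differential, normalised so that
   (d alpha)(x, y) = - alpha([x, y]) on 1-forms. *)
Definition CE_d k (alpha : kform k) : kform k.+1 := fun X =>
  \sum_(i < k.+1) \sum_(j < k.+1 | (i < j)%N)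
    (-1) ^+ (i + j) * alpha (CE_arg X i j).

(* A coframe e^1, .., e^n is given by the frame b of which it is the dual
   basis: e^i is [coord b] at the (0-based) index i - 1. *)
Definition vol n (b : n.-tuple g) : kform n := fun X =>
  \det (\matrix_(p, q) coord b p (X q)).

(* Hodge star of the metric and orientation for which b is an oriented
   orthonormal frame:
   ( *alpha)(Y) = 1/k! \sum_I alpha(b_I) vol(b_I, Y), I in {1..k+m}^k,
   so that alpha /\ *beta = <alpha, beta> vol. *)
Definition hodge k m (b : (k + m).-tuple g) (alpha : kform k) : kform m :=
  fun Y =>
    (k`!)%:R^-1 * \sum_(I : {ffun 'I_k -> 'I_(k + m)})
      alpha [ffun p => tnth b (I p)] *
      vol b [ffun q => match split q with
                       | inl p => tnth b (I p)
                       | inr r => Y r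
                       end].

(* e^{s_1} /\ .. /\ e^{s_k}, with 1-based indices s_i. *)
Definition wedge (b : 7.-tuple g) k (s : k.-tuple nat) : kform k := fun X =>
  \det (\matrix_(p, q) coord b (inord (tnth s p).-1) (X q)).

Definition wedge3 (b : 7.-tuple g) (i j k : nat) : kform 3 :=
  wedge b [tuple i; j; k].

Definition g2_model (b : 7.-tuple g) : kform 3 := fun X =>
  wedge3 b 1 2 7 X + wedge3 b 3 4 7 X + wedge3 b 5 6 7 X + wedge3 b 1 3 5 X
  - wedge3 b 1 4 6 X - wedge3 b 2 3 6 X - wedge3 b 2 4 5 X.

Definition G2_adapted (phi : kform 3) (b : 7.-tuple g) : Prop :=
  [/\ altform phi, basis_of fullv b & phi =1 g2_model b].

(* d(star phi) = 0, the star being taken in the adapted coframe; it does not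
   depend on the choice of that coframe. *)
Definition G2_coclosed (phi : kform 3) (b : 7.-tuple g) : Prop :=
  forall X, CE_d (@hodge 3 4 b phi) X = 0.

Definition coframe_metric n (b : n.-tuple g) (x y : g) : R :=
  \sum_(i < n) coord b i x * coord b i y.

Definition inner_product (q : g -> g -> R) : Prop :=
  [/\ bilinear_for *%R *%R q, forall x y, q x y = q y x
    & forall x, x != 0 -> 0 < q x x].

(* Levi-Civita connection of the left-invariant metric q, on left-invariant
   vector fields: torsion-free and metric (q being constant on such fields). *)
Definition levi_civita (q : g -> g -> R) (nabla : {bilinear g -> g -> g}) :
    Prop :=
  (forall x y, nabla x y - nabla y x = [| x, y |]) /\
  (forall x y z, q (nabla x y) z + q y (nabla x z) = 0).

Definition curvature (nabla : {bilinear g -> g -> g}) (x y z : g) : g :=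
  nabla x (nabla y z) - nabla y (nabla x z) - nabla [| x, y |] z.

Definition trace (f : g -> g) : R :=
  let B := vbasis {:g} in \sum_(i < \dim {:g}) coord B i (f (tnth B i)).

Definition ricci_tensor (nabla : {bilinear g -> g -> g}) (y z : g) : R :=
  trace (fun x => curvature nabla x y z).

Definition ricci_endo (q : g -> g -> R) (Ric : 'End(g)) : Prop :=
  exists nabla : {bilinear g -> g -> g}, levi_civita q nabla /\
    forall y z, q (Ric y) z = ricci_tensor nabla y z.

Definition nilsoliton (q : g -> g -> R) : Prop :=
  inner_product q /\
  exists (Ric : 'End(g)) (lambda : R) (D : 'End(g)),
    [/\ ricci_endo q Ric, lie_derivation D & Ric = lambda *: \1%VF + D].

End LieAlgebras.

(* Main.v *)
Require Import Defs.
From HB Require Import structures.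
From mathcomp Require Import all_boot all_order all_fingroup all_algebra.
From mathcomp Require Import boolp reals ring zify.
Import Order.TTheory GRing.Theory Num.Theory.
Local Open Scope ring_scope.
Set Implicit Arguments.
Unset Strict Implicit.
Unset Printing Implicit Defensive.

(* Since g is decomposable, its center Z is strictly larger than the derived
   algebra C. If dim C = 1, symplectic reduction of the bracket gives h3 + R^4 or
   h5 + R^2. If dim C >= 3, then g/Z is 3-dimensional and the brackets of three
   generators are independent: g is the free 2-step algebra on 3 generators plus
   R. If dim C = 2, choose x with ad x of rank 2, and u spanning ker (ad x) together
   with Z and x. Identifying g / ker (ad x) with C by ad x, ad u becomes a 2 x 2
   matrix whose conjugacy class, modulo scalar matrices, determines g: complex
   eigenvalues give the complex Heisenberg algebra plus R, two real eigenvalues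
   h3 + h3 + R, a Jordan block (0,0,0,0,12,14+23) + R and a scalar matrix
   (0,0,0,12,13) + R^2.
   Each of these seven algebras has a G2-adapted frame with structure constants
   0, 1, -1, for which the 4-form is closed, the Ricci tensor is diagonal and
   Ric - lambda I is a derivation; these are finite computations with integers. *)

(** The strict inclusion of C in Z enters through dimensions: dim Z is at least 2, 3 or 4 according
    as dim C is 1, 2 or at least 3. This excludes the seven-dimensional Heisenberg algebra in the
    first case, provides [u] in the second, and leaves at most three generators modulo Z in the
    third. No isomorphism with a model algebra is constructed. A normal form is reached by
    exhibiting in g itself vectors X, independent modulo Z, and vectors Y of Z with prescribed
    brackets; central vectors complete them to a frame, which is declared orthonormal. The finite
    computations rest on multilinearity: an alternating form is determined by its values on
    increasing tuples of basis vectors, and these values, like four times the Ricci components, are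
    images in R of integer expressions in the structure constants. *)

Local Notation br := (@lie _ _).

(** * Alternating forms *)

Section AlternatingForms.
Context (R : realType) (g : lieAlgebra R).

Lemma eq_altform k (al be : kform g k) : al =1 be -> altform al -> altform be.
Proof.
by move=> e [lin alt]; split=> [X i a u v|X i j ij Xij]; rewrite -!e ?lin ?(alt X i j).
Qed.

Lemma altformN k (al : kform g k) : altform al -> altform (fun X => - al X).
Proof.
move=> [lin alt]; split=> [X i a u v|X i j ij Xij]; last by rewrite (alt X i j) ?oppr0.
by rewrite lin; ring.
Qed.

Lemma altformD k (al be : kform g k) :
  altform al -> altform be -> altform (fun X => al X + be X).
Proof.
move=> [lina alta] [linb altb]; split=> [X i a u v|X i j ij Xij].
  by rewrite lina linb; ring.
by rewrite (alta X i j) // (altb X i j) // addr0.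
Qed.

Lemma updE k (X : {ffun 'I_k -> g}) i v j :
  upd X i v j = if j == i then v else X j.
Proof. by rewrite ffunE. Qed.

Lemma upd_id k (X : {ffun 'I_k -> g}) i : upd X i (X i) = X.
Proof. by apply/ffunP => j; rewrite updE; case: eqP => // ->. Qed.

Lemma updC k (X : {ffun 'I_k -> g}) i j u v :
  i != j -> upd (upd X i u) j v = upd (upd X j v) i u.
Proof.
move=> ij; apply/ffunP => l; rewrite !updE; case: (eqVneq l j) => // ->.
by rewrite eq_sym (negPf ij).
Qed.

Section OneForm.
Context (k : nat) (al : kform g k) (alP : altform al).

Lemma altform_updD X i u v : al (upd X i (u + v)) = al (upd X i u) + al (upd X i v).
Proof. by have := alP.1 X i 1 u v; rewrite scale1r mul1r. Qed.

Lemma altform_upd0 X i : al (upd X i 0) = 0.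
Proof.
by have := altform_updD X i 0 0; rewrite addr0 -[X in X = _]addr0 => /addrI.
Qed.

Lemma altform_updZ X i a u : al (upd X i (a *: u)) = a * al (upd X i u).
Proof. by have := alP.1 X i a u 0; rewrite addr0 altform_upd0 addr0. Qed.

Lemma altform_upd_sum X i (I : finType) (F : I -> g) :
  al (upd X i (\sum_j F j)) = \sum_j al (upd X i (F j)).
Proof.
elim/big_rec2: _ => [|j x y _ <-]; first exact: altform_upd0.
exact: altform_updD.
Qed.

(** Polarization: expand the vanishing value of the form with [X i + X j] in both slots. *)
Lemma altform_tperm (X : {ffun 'I_k -> g}) i j :
  i != j -> al [ffun l => X (tperm i j l)] = - al X.
Proof.
move=> ij; pose Y u v := upd (upd X i u) j v.
have Yi u v l : Y u v l = if l == j then v else if l == i then u else X l.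
  by rewrite /Y !updE.
have D0 u : al (Y u u) = 0.
  by apply: (alP.2 _ i j) => //; rewrite !Yi !eqxx (negPf ij).
have := D0 (X i + X j); rewrite {1}/Y altform_updD !(updC _ _ _ ij) !altform_updD.
rewrite -!(updC _ _ _ ij) -!/(Y _ _) !D0 add0r addr0.
have -> : Y (X i) (X j) = X.
  by apply/ffunP => l; rewrite Yi; do 2?case: eqP => [->|_ //].
have -> : Y (X j) (X i) = [ffun l => X (tperm i j l)].
  apply/ffunP => l; rewrite Yi ffunE; case: tpermP => [->|->|].
  - by rewrite (negPf ij) eqxx.
  - by rewrite eqxx.
  - by move=> /eqP/negPf-> /eqP/negPf->.
by move/eqP; rewrite addr_eq0 => /eqP.
Qed.

Lemma altform_perm (X : {ffun 'I_k -> g}) (s : {perm 'I_k}) :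
  al [ffun l => X (s l)] = (-1) ^+ s * al X.
Proof.
have [ts -> dts] := prod_tpermP s.
elim: ts dts X => [_|[i j] ts IH /= /andP[ij dts]] X.
  rewrite big_nil odd_perm1 mul1r; congr al; apply/ffunP => l.
  by rewrite ffunE perm1.
rewrite big_cons odd_mul_tperm ij signr_addb expr1 -mulrA -(IH dts) mulN1r.
rewrite -(altform_tperm _ ij); congr al; apply/ffunP => l.
by rewrite !ffunE permM.
Qed.

Lemma altform_repeat (X : {ffun 'I_k -> g}) : ~~ injectiveb X -> al X = 0.
Proof.
case/injectivePn => i [j ij e]; exact: (alP.2 X i j).
Qed.

Context (n : nat) (b : n.-tuple g) (bB : basis_of fullv b).

Lemma altform_basis :
  (forall I : {ffun 'I_k -> 'I_n}, al [ffun i => tnth b (I i)] = 0) ->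
  forall X, al X = 0.
Proof.
move=> al0; pose basisv (X : {ffun 'I_k -> g}) i := exists j, X i = tnth b j.
(* The slots from [m] on already hold basis vectors; the induction step expands one more slot in the
   basis. *)
suff H m X : (forall i : 'I_k, (m <= i)%N -> basisv X i) -> al X = 0.
  by move=> X; apply: (H k) => i; rewrite leqNgt ltn_ord.
elim: m X => [X bX|m IH X bX].
  have bI i : exists j, X i == tnth b j.
    by have [j ->] := bX i isT; exists j.
  rewrite -(al0 [ffun i => xchoose (bI i)]); congr al; apply/ffunP => i.
  by rewrite !ffunE; apply/eqP/(xchooseP (bI i)).
case: (ltnP m k) => [mk|km]; last first.
  by apply: IH => i mi; have := ltn_ord i; rewrite ltnNge (leq_trans km mi).
pose i0 := Ordinal mk.
rewrite -(upd_id X i0) (coord_basis bB (memvf (X i0))) altform_upd_sum.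
apply: big1 => j _; rewrite altform_updZ IH ?mulr0 // => i mi.
rewrite /basisv updE; case: eqVneq => [_|ii0].
  by exists j; rewrite (tnth_nth 0).
apply: bX; rewrite ltn_neqAle mi andbT; apply: contra ii0 => /eqP e.
by apply/eqP/val_inj; rewrite /= e.
Qed.

Lemma altform_increasing :
  (forall I : {ffun 'I_k -> 'I_n}, (forall i j : 'I_k, (i < j)%N -> (I i < I j)%N) ->
    al [ffun i => tnth b (I i)] = 0) ->
  forall X, al X = 0.
Proof.
move=> al0; apply: altform_basis => I.
have [/injectiveP injI|ninj] := boolP (injectiveb I); last first.
  apply: altform_repeat; apply: contra ninj => /injectiveP inj.
  by apply/injectiveP => i j e; apply: inj; rewrite !ffunE e.
(* The sorting permutation [p] of the values of [I] makes [I] increasing, strictly so by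
   injectivity, and costs only a sign. *)
pose t := [tuple val (I i) | i < k].
have [p tp] : exists p : {perm 'I_k}, sort leq t = [tuple tnth t (p i) | i < k].
  by apply/tuple_permP; rewrite perm_sort.
have tP i : nth 0%N (sort leq t) (val i) = I (p i).
  by rewrite tp -tnth_nth !tnth_mktuple.
have sorted_t : sorted ltn (sort leq t).
  rewrite ltn_sorted_uniq_leq sort_uniq sort_sorted ?andbT; last exact: leq_total.
  by rewrite map_inj_uniq ?val_ord_tuple ?enum_uniq //; move=> i j /val_inj/injI.
have st : size (sort leq t) = k by rewrite size_sort size_tuple.
have /(congr1 ( *%R ((-1) ^+ p))) : al [ffun i => tnth b ([ffun j => I (p j)] i)] = 0.
  apply: al0; move=> i j ij; rewrite /= !ffunE -!tP.
  by refine (sorted_ltn_nth ltn_trans 0%N sorted_t i j _ _ ij); rewrite inE st.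
rewrite mulr0 => <-.
rewrite (_ : finfun _ = [ffun l => [ffun i => tnth b (I i)] (p l)]); last first.
  by apply/ffunP => i; rewrite !ffunE.
by rewrite altform_perm mulrA -signr_addb addbb mul1r.
Qed.

End OneForm.
End AlternatingForms.

Section MoreAlternating.
Context (R : realType) (g : lieAlgebra R).

Lemma altform_det k (F : 'I_k -> {linear g -> R^o}) :
  altform (fun X : {ffun 'I_k -> g} => \det (\matrix_(p, q) F p (X q))).
Proof.
split=> [X i a u v|X i j ij Xij].
  rewrite -[in RHS](mul1r (\det (\matrix_(p, q) F p (upd X i v q)))).
  rewrite -!(det_tr (\matrix_(p, q) _)).
  apply: (determinant_multilinear (i0 := i)).
  - by apply/rowP => q; rewrite !mxE !updE eqxx linearP mul1r.
  - by apply/matrixP => p q; rewrite !mxE !updE eq_sym (negPf (neq_lift _ _)).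
  - by apply/matrixP => p q; rewrite !mxE !updE eq_sym (negPf (neq_lift _ _)).
rewrite -det_tr; apply: (determinant_alternate ij) => q.
by rewrite !mxE Xij.
Qed.

Lemma altform_scale k (al : kform g k) c :
  altform al -> altform (fun X => c * al X).
Proof.
move=> [lin alt]; split=> [X i a u v|X i j ij Xij].
  by rewrite lin; ring.
by rewrite (alt X i j) ?mulr0.
Qed.

Lemma altform_sum k (I : Type) (r : seq I) (F : I -> kform g k) :
  (forall i, altform (F i)) -> altform (fun X => \sum_(i <- r) F i X).
Proof.
move=> FP; split=> [X i a u v|X i j ij Xij].
  by rewrite mulr_sumr -big_split; apply: eq_bigr => l _; rewrite (FP l).1.
by apply: big1 => l _; rewrite ((FP l).2 X i j).
Qed.

Section Coframe.
Context (n : nat) (b : n.-tuple g).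

Lemma altform_vol : altform (vol b).
Proof. exact: (altform_det (fun p => coord b p)). Qed.

End Coframe.

Definition fcat k m (Z : {ffun 'I_k -> g}) (Y : {ffun 'I_m -> g}) :
    {ffun 'I_(k + m) -> g} :=
  [ffun q => match split q with inl p => Z p | inr r => Y r end].

Lemma fcat_updl k m (Z : {ffun 'I_k -> g}) (Y : {ffun 'I_m -> g}) i v :
  fcat (upd Z i v) Y = upd (fcat Z Y) (lshift m i) v.
Proof.
apply/ffunP => q; rewrite !ffunE; case: splitP => p qp.
  by rewrite !ffunE -!val_eqE /= qp.
rewrite -val_eqE /= qp; case: eqVneq => // e.
by have := ltn_ord i; rewrite -e ltnNge leq_addr.
Qed.

Lemma fcat_updr k m (Z : {ffun 'I_k -> g}) (Y : {ffun 'I_m -> g}) i v :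
  fcat Z (upd Y i v) = upd (fcat Z Y) (rshift k i) v.
Proof.
apply/ffunP => q; rewrite !ffunE; case: splitP => p qp; last first.
  by rewrite !ffunE -!val_eqE /= qp eqn_add2l.
rewrite -val_eqE /= qp; case: eqVneq => // e.
by have := ltn_ord p; rewrite e ltnNge leq_addr.
Qed.

Lemma altform_fcatl k m (al : kform g (k + m)) (Y : {ffun 'I_m -> g}) :
  altform al -> altform (fun Z : {ffun 'I_k -> g} => al (fcat Z Y)).
Proof.
move=> alP; split=> [X i a u v|X i j ij Xij]; first by rewrite !fcat_updl alP.1.
apply: (alP.2 _ (lshift m i) (lshift m j)).
  by apply: contra ij => /eqP/lshift_inj ->.
by rewrite !ffunE !(unsplitK (inl _)).
Qed.

Lemma altform_fcatr k m (al : kform g (k + m)) (Z : {ffun 'I_k -> g}) :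
  altform al -> altform (fun Y : {ffun 'I_m -> g} => al (fcat Z Y)).
Proof.
move=> alP; split=> [X i a u v|X i j ij Xij]; first by rewrite !fcat_updr alP.1.
apply: (alP.2 _ (rshift k i) (rshift k j)).
  by apply: contra ij => /eqP/rshift_inj ->.
by rewrite !ffunE !(unsplitK (inr _)).
Qed.

Lemma altform_hodge k m (b : (k + m).-tuple g) (al : kform g k) :
  altform (hodge b al).
Proof.
apply: altform_scale; apply: altform_sum => I; apply: altform_scale.
apply: eq_altform (altform_fcatr [ffun p => tnth b (I p)] (altform_vol b)) => Y.
by congr vol; apply/ffunP => q; rewrite !ffunE; case: split => // p; rewrite ffunE.
Qed.

(** Expand the determinant over permutations [t] and exchange the sums. For each [t] only the tuple
    [I] equal to [s] composed with [t] survives, and the two signs cancel; the k! equal terms absorb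
    the normalisation. A non-injective [s] needs no separate treatment. *)
Lemma hodge_det k m (b : (k + m).-tuple g) (s : {ffun 'I_k -> 'I_(k + m)}) Y :
  free b ->
  hodge b (fun X => \det (\matrix_(p, q) coord b (s p) (X q))) Y =
  vol b (fcat [ffun p => tnth b (s p)] Y).
Proof.
move=> bfree.
pose V (I : {ffun 'I_k -> 'I_(k + m)}) := vol b (fcat [ffun p => tnth b (I p)] Y).
have V_perm (t : {perm 'I_k}) : V [ffun i => s (t i)] = (-1) ^+ t * V s.
  rewrite /V -(altform_perm (altform_fcatl Y (altform_vol b))).
  by congr (vol b (fcat _ Y)); apply/ffunP => i; rewrite !ffunE.
rewrite /hodge.
under eq_bigr => I _.
  rewrite (_ : vol _ _ = V I); last first.
    by congr vol; apply/ffunP => q; rewrite !ffunE; case: split => // p; rewrite ffunE.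
  rewrite -det_tr /determinant mulr_suml.
  over.
rewrite exchange_big /= (eq_bigr (fun=> V s)) => [|t _].
  rewrite sumr_const card_Sn.
  by rewrite -[V s *+ _]mulr_natl mulrA mulVf ?mul1r // pnatr_eq0 -lt0n fact_gt0.
rewrite (bigD1 [ffun i => s (t i)]) //= [X in _ + X]big1 ?addr0 => [|I Is].
  rewrite V_perm big1 ?mulr1 => [|i _].
    by rewrite mulrA -signr_addb addbb mul1r.
  by rewrite !mxE !ffunE (tnth_nth 0) coord_free // ?eqxx.
suff -> : \prod_i (\matrix_(p, q) coord b (s p) ([ffun p0 => tnth b (I p0)] q))^T i (t i) = 0.
  by rewrite mulr0 mul0r.
have [i Ii] : exists i, I i != s (t i).
  apply/existsP; apply: contraR Is; rewrite negb_exists => /forallP h.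
  by apply/eqP/ffunP => i; rewrite ffunE; apply/eqP; have := h i; rewrite negbK.
rewrite (bigD1 i) //= !mxE !ffunE (tnth_nth 0) coord_free //.
by rewrite (negPf Ii) mul0r.
Qed.

End MoreAlternating.

(** * Evaluation of forms on a basis *)

Definition isum n (F : nat -> int) : int := foldr (fun i a => F i + a) 0 (iota 0 n).

Lemma isumE (R : pzRingType) n F : (isum n F)%:~R = \sum_(i < n) (F i)%:~R :> R.
Proof.
rewrite -(big_mkord xpredT (fun i => (F i)%:~R)) /index_iota subn0 /isum.
elim: (iota 0 n) => [|i s IH]; first by rewrite big_nil.
by rewrite big_cons /= rmorphD /= IH.
Qed.

(** Laplace expansion along the first column, in a form that [vm_compute] evaluates. The zero test
    skips the minors of zero entries, which keeps sparse 0/1 matrices of size 7 cheap. *)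
Fixpoint idet n (F : nat -> nat -> int) : int :=
  if n is n'.+1 then
    isum n (fun i => if F i 0%N == 0 then 0 else
      (if odd i then - F i 0%N else F i 0%N) *
      idet n' (fun p q => F (bump i p) q.+1))
  else 1.

Lemma idetE (R : comPzRingType) n (F : nat -> nat -> int) :
  \det (\matrix_(p < n, q < n) (F p q)%:~R) = (idet n F)%:~R :> R.
Proof.
elim: n F => [|n IH] F; first by rewrite det_mx00.
rewrite (expand_det_col _ ord0) isumE; apply: eq_bigr => i _.
rewrite !mxE; case: eqP => [->|_]; first by rewrite mul0r.
rewrite /cofactor addn0 [X in _ * (_ * X)](_ : _ =
    (idet n (fun p q => F (bump i p) q.+1))%:~R); last first.
  by rewrite -IH; congr (\det _); apply/matrixP => p q; rewrite !mxE.
rewrite -signr_odd rmorphM /=; case: odd; rewrite ?rmorphN /=; ring.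
Qed.

Fixpoint increasing_seqs k m n : seq (seq nat) :=
  if k is k'.+1 then
    flatten [seq [seq i :: l | l <- increasing_seqs k' i.+1 n] | i <- iota m (n - m)]
  else [:: [::]].

Lemma increasing_seqsP k m n (l : seq nat) : size l = k -> sorted ltn l ->
  all (fun i => m <= i < n)%N l -> l \in increasing_seqs k m n.
Proof.
elim: k m l => [|k IH] m [|i l] //= [sl] il /andP[/andP[mi im] bl].
apply/flattenP; exists [seq i :: l' | l' <- increasing_seqs k i.+1 n].
  by apply: map_f; rewrite mem_iota mi subnKC // (leq_trans mi (ltnW im)).
apply: map_f; apply: IH => //; first exact: path_sorted il.
have /allP il' := order_path_min ltn_trans il.
by apply/allP => j jl; rewrite il' //=; case/andP: (allP bl _ jl).
Qed.

Section BasisEvaluation.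
Context (R : realType) (g : lieAlgebra R).

Definition vecs k (l : seq g) : {ffun 'I_k -> g} := [ffun i : 'I_k => nth 0 l i].

Section Basis.
Context (n : nat) (b : n.-tuple g) (bB : basis_of fullv b).

Definition bvecs k (l : seq nat) : {ffun 'I_k -> g} :=
  [ffun i : 'I_k => nth 0 b (nth 0%N l i)].

Lemma altform_increasing_seqs k (al : kform g k) : altform al ->
  (forall l, l \in increasing_seqs k 0 n -> al (bvecs k l) = 0) ->
  forall X, al X = 0.
Proof.
move=> alP al0; apply: (altform_increasing alP bB) => I Iincr.
pose l := [seq val (I i) | i <- enum 'I_k].
have nl (i : 'I_k) : nth 0%N l i = I i.
  by rewrite (nth_map i) ?size_enum_ord // nth_ord_enum.
rewrite -[RHS](al0 l).
  by congr al; apply/ffunP => i; rewrite !ffunE nl (tnth_nth 0).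
have sl : size l = k by rewrite size_map size_enum_ord.
apply: increasing_seqsP => //.
  apply/(sortedP 0%N) => i; rewrite sl => ik.
  by have := Iincr (Ordinal (ltnW ik)) (Ordinal ik) (ltnSn i); rewrite -!nl.
by apply/allP => _ /mapP[i _ ->] /=.
Qed.

Lemma coord_bvecs k l (i : 'I_n) (q : 'I_k) : all (gtn n) l -> size l = k ->
  coord b i (bvecs k l q) = (Posz (i == nth 0%N l q :> nat))%:~R.
Proof.
move=> ln sl; have iq : (nth 0%N l q < n)%N by apply: (all_nthP 0%N ln); rewrite sl.
rewrite ffunE -[nth 0%N l q]/(val (Ordinal iq)) coord_free ?(basis_free bB) //.
by rewrite eq_sym -val_eqE.
Qed.

End Basis.
End BasisEvaluation.

(** The generalised Kronecker delta: for lists of length [k], the sign of the permutation taking [s]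
    to [l], or 0 if there is none or an index is repeated. *)
Definition delta_det k (s l : seq nat) : int :=
  idet k (fun p q => Posz (nth 0%N s p == nth 0%N l q)).

(** * The Hodge dual of the model 3-form *)

Section Frame7.
Context (R : realType) (g : lieAlgebra R) (b : 7.-tuple g) (bB : basis_of fullv b).

Lemma wedge_bvecs k (s : k.-tuple nat) l :
  all (fun i => 0 < i < 8)%N s -> all (gtn 7) l -> size l = k ->
  wedge b s (bvecs b k l) = (delta_det k (map predn s) l)%:~R.
Proof.
move=> s7 l7 sl; rewrite -idetE; congr (\det _); apply/matrixP => p q.
have sp : (0 < tnth s p < 8)%N by apply: (allP s7); apply: mem_tnth.
rewrite !mxE (coord_bvecs bB) // inordK; last by case: (tnth s p) sp.
by rewrite (nth_map 0%N) ?size_tuple // -tnth_nth.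
Qed.

Definition star_g2_model : kform g 4 := fun X =>
  wedge b [tuple 1; 2; 3; 4] X + wedge b [tuple 1; 2; 5; 6] X +
  wedge b [tuple 1; 3; 6; 7] X + wedge b [tuple 1; 4; 5; 7] X +
  wedge b [tuple 2; 3; 5; 7] X - wedge b [tuple 2; 4; 6; 7] X +
  wedge b [tuple 3; 4; 5; 6] X.

Lemma altform_wedge k (s : k.-tuple nat) : altform (wedge b s).
Proof. exact: (altform_det (fun p => coord b (inord (tnth s p).-1))). Qed.

Lemma altform_g2_model : altform (g2_model b).
Proof.
by do ![apply: altformD | apply: altformN | apply: altform_wedge].
Qed.

Lemma altform_star_g2_model : altform star_g2_model.
Proof.
by do ![apply: altformD | apply: altformN | apply: altform_wedge].
Qed.

(** The seven terms of [star_g2_model], with indices lowered by one. *)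
Definition star_coef (l : seq nat) : int :=
  delta_det 4 [:: 0; 1; 2; 3] l + delta_det 4 [:: 0; 1; 4; 5] l +
  delta_det 4 [:: 0; 2; 5; 6] l + delta_det 4 [:: 0; 3; 4; 6] l +
  delta_det 4 [:: 1; 2; 4; 6] l - delta_det 4 [:: 1; 3; 5; 6] l +
  delta_det 4 [:: 2; 3; 4; 5] l.

Lemma star_g2_model_bvecs l : all (gtn 7) l -> size l = 4%N ->
  star_g2_model (bvecs b 4 l) = (star_coef l)%:~R.
Proof.
move=> l7 sl; have W s := @wedge_bvecs 4 s l ^~ l7 ^~ sl.
have sumE (c1 c2 c3 c4 c5 c6 c7 : int) : (c1 + c2 + c3 + c4 + c5 - c6 + c7)%:~R =
    c1%:~R + c2%:~R + c3%:~R + c4%:~R + c5%:~R - c6%:~R + c7%:~R :> R.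
  by rewrite !(intrB, intrD).
by rewrite /star_g2_model; do 7?[rewrite W; last by []]; rewrite sumE.
Qed.

Lemma hodgeD (al be : kform g 3) Y :
  @hodge _ _ 3 4 b (fun X => al X + be X) Y = @hodge _ _ 3 4 b al Y + @hodge _ _ 3 4 b be Y.
Proof.
rewrite /hodge -mulrDr -big_split /=; congr (_ * _).
by apply: eq_bigr => I _; rewrite mulrDl.
Qed.

Lemma hodgeN (al : kform g 3) Y :
  @hodge _ _ 3 4 b (fun X => - al X) Y = - @hodge _ _ 3 4 b al Y.
Proof.
rewrite /hodge -mulrN -sumrN; congr (_ * _).
by apply: eq_bigr => I _; rewrite mulNr.
Qed.

Lemma hodge_wedge3_bvecs i j k l : all (fun i => 0 < i < 8)%N [:: i; j; k] ->
  all (gtn 7) l -> size l = 4%N ->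
  @hodge _ _ 3 4 b (wedge3 b i j k) (bvecs b 4 l) =
  (delta_det 7 (iota 0 7) [:: i.-1, j.-1, k.-1 & l])%:~R.
Proof.
move=> ijk l7 sl; pose s : {ffun 'I_3 -> 'I_7} :=
  [ffun p => inord (tnth [tuple i; j; k] p).-1].
rewrite (_ : wedge3 b i j k = wedge b [tuple i; j; k]) //.
transitivity (@hodge _ _ 3 4 b
    (fun X => \det (\matrix_(p, q) coord b (s p) (X q))) (bvecs b 4 l)).
  congr (_ * _); apply: eq_bigr => I _; congr (\det _ * _).
  by apply/matrixP => p q; rewrite !mxE [s p]ffunE.
rewrite (@hodge_det _ _ 3 4) ?(basis_free bB) // -idetE.
congr (\det _); apply/matrixP => p q; rewrite !mxE.
have sl' : size [:: i.-1, j.-1, k.-1 & l] = 7 by rewrite /= sl.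
have pred7 x : (0 < x < 8)%N -> (x.-1 < 7)%N by case: x.
have l7' : all (gtn 7) [:: i.-1, j.-1, k.-1 & l].
  by case/and4P: ijk => /pred7 i7 /pred7 j7 /pred7 k7 _; rewrite /= i7 j7 k7.
rewrite nth_iota // add0n -(coord_bvecs bB) //; congr (coord b p _).
rewrite ffunE; case: splitP => r qr; rewrite !ffunE qr //.
rewrite (tnth_nth 0) inordK; last first.
  by apply: pred7; apply: (allP ijk); apply: mem_tnth.
by rewrite (tnth_nth 0%N) /=; case: r {qr} => [[|[|[|]]]].
Qed.

(** Both sides are alternating, so the 35 increasing quadruples of basis vectors decide, and on each
    of them the equality is one between integers. *)
Lemma hodge_g2_model : @hodge _ _ 3 4 b (g2_model b) =1 star_g2_model.
Proof.
move=> Y; apply/eqP; rewrite -subr_eq0; apply/eqP; move: Y.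
apply: (altform_increasing_seqs bB) => [|l lP].
  apply: altformD; first exact: (@altform_hodge _ _ 3 4).
  exact: altformN altform_star_g2_model.
have [l7 sl] : all (gtn 7) l /\ size l = 4%N.
  suff /andP[-> /eqP] : all (gtn 7) l && (size l == 4%N) by [].
  by move: l lP; apply/allP; vm_compute.
rewrite star_g2_model_bvecs // /g2_model !(hodgeD, hodgeN).
have W i j k := @hodge_wedge3_bvecs i j k l ^~ l7 ^~ sl.
do 7?[rewrite W; last by []].
have sumE (c1 c2 c3 c4 c5 c6 c7 c8 : int) :
    c1%:~R + c2%:~R + c3%:~R + c4%:~R - c5%:~R - c6%:~R - c7%:~R - c8%:~R =
    (c1 + c2 + c3 + c4 - c5 - c6 - c7 - c8)%:~R :> R.
  by rewrite !(intrB, intrD).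
rewrite sumE.
set z := _ - _; suff -> : z = 0 by [].
apply/eqP; rewrite {}/z; move: l lP {W l7 sl}; apply/allP.
by vm_compute.
Qed.

End Frame7.

(** * The Chevalley-Eilenberg differential of 4-forms *)

(* The pattern of signs and arguments of the Chevalley-Eilenberg differential of
   a 4-form, T x y z t u standing for alpha([x, y], z, t, u). *)
Definition ext_d4 (A : zmodType) (V : Type) (T : V -> V -> V -> V -> V -> A)
    (x0 x1 x2 x3 x4 : V) : A :=
  - T x0 x1 x2 x3 x4 + T x0 x2 x1 x3 x4 - T x0 x3 x1 x2 x4 + T x0 x4 x1 x2 x3
  - T x1 x2 x0 x3 x4 + T x1 x3 x0 x2 x4 - T x1 x4 x0 x2 x3 - T x2 x3 x0 x1 x4
  + T x2 x4 x0 x1 x3 - T x3 x4 x0 x1 x2.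

Lemma ext_d4_intr (R : pzRingType) V (T : V -> V -> V -> V -> V -> int) x0 x1 x2 x3 x4 :
  (ext_d4 T x0 x1 x2 x3 x4)%:~R =
  ext_d4 (fun x y z t u => (T x y z t u)%:~R : R) x0 x1 x2 x3 x4.
Proof. by rewrite /ext_d4 !(intrB, intrD) rmorphN. Qed.

Section Differential.
Context (R : realType) (g : lieAlgebra R).

Lemma lie_anti (x y : g) : br y x = - br x y.
Proof.
have := lie_alt (x + y); rewrite linearDl !linearDr !lie_alt add0r addr0.
by move/eqP; rewrite addrC addr_eq0 => /eqP.
Qed.

Lemma CE_arg_vecs k (X : {ffun 'I_k.+1 -> g}) (i j : 'I_k.+1) :
  CE_arg X i j = vecs k (br (X i) (X j) ::
    [seq X (inord (bump i (bump j.-1 p))) | p <- iota 0 k.-1]).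
Proof.
apply/ffunP => p; rewrite !ffunE; case: eqP => [->//|p0].
case: p p0 => [[|p] pk] //= _; have pk' : (p < k.-1)%N by case: k {X i j} pk.
by rewrite (nth_map 0%N) ?nth_iota ?size_iota.
Qed.

Section FourForm.
Context (al : kform g 4) (alP : altform al).

Local Notation N u x y z := (al (vecs 4 [:: u; x; y; z])).

Let d4 := ext_d4 (fun x y z t u : g => N (br x y) z t u).

Let CE_d4 X :
  CE_d al X = d4 (X (inord 0)) (X (inord 1)) (X (inord 2)) (X (inord 3)) (X (inord 4)).
Proof.
pose G i j := (-1) ^+ (i + j) * al (vecs 4 (br (X (inord i)) (X (inord j)) ::
    [seq X (inord (bump i (bump j.-1 p))) | p <- iota 0 3])).
(* With [nat] indices, unlocking the sums leaves the ten terms explicit. *)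
have -> : CE_d al X = \sum_(0 <= i < 5) \sum_(0 <= j < 5 | (i < j)%N) G i j.
  rewrite big_mkord; apply: eq_bigr => i _; rewrite big_mkord.
  by apply: eq_bigr => j _; rewrite CE_arg_vecs /G !inord_val.
rewrite unlock /= /G /bump /= /d4 /ext_d4; ring.
Qed.

Let vecs_upd (l : seq g) (i : 'I_4) v : size l = 4%N ->
  vecs 4 (set_nth 0 l i v) = upd (vecs 4 l) i v.
Proof. by move=> sl; apply/ffunP => j; rewrite !ffunE nth_set_nth. Qed.

Let N1 a u v x y z : N (a *: u + v) x y z = a * N u x y z + N v x y z.
Proof.
have H w := @vecs_upd [:: 0; x; y; z] (@Ordinal 4 0 isT) w erefl.
by rewrite /= in H; rewrite (H (a *: u + v)) (H u) (H v) alP.1.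
Qed.

Let N2 a u v x y z : N x (a *: u + v) y z = a * N x u y z + N x v y z.
Proof.
have H w := @vecs_upd [:: x; 0; y; z] (@Ordinal 4 1 isT) w erefl.
by rewrite /= in H; rewrite (H (a *: u + v)) (H u) (H v) alP.1.
Qed.

Let N3 a u v x y z : N x y (a *: u + v) z = a * N x y u z + N x y v z.
Proof.
have H w := @vecs_upd [:: x; y; 0; z] (@Ordinal 4 2 isT) w erefl.
by rewrite /= in H; rewrite (H (a *: u + v)) (H u) (H v) alP.1.
Qed.

Let N4 a u v x y z : N x y z (a *: u + v) = a * N x y z u + N x y z v.
Proof.
have H w := @vecs_upd [:: x; y; z; 0] (@Ordinal 4 3 isT) w erefl.
by rewrite /= in H; rewrite (H (a *: u + v)) (H u) (H v) alP.1.
Qed.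

Let d4_lin :
  (forall a u v x y z t, d4 (a *: u + v) x y z t = a * d4 u x y z t + d4 v x y z t) *
  (forall a u v x y z t, d4 x (a *: u + v) y z t = a * d4 x u y z t + d4 x v y z t) *
  (forall a u v x y z t, d4 x y (a *: u + v) z t = a * d4 x y u z t + d4 x y v z t) *
  (forall a u v x y z t, d4 x y z (a *: u + v) t = a * d4 x y z u t + d4 x y z v t) *
  (forall a u v x y z t, d4 x y z t (a *: u + v) = a * d4 x y z t u + d4 x y z t v).
Proof.
by do !split; move=> a u v x y z t;
   rewrite /d4 /ext_d4 /= ?linearPl ?linearPr ?(N1, N2, N3, N4); ring.
Qed.

Let N0 x y z : N 0 x y z = 0.
Proof.
have := N1 1 0 0 x y z; rewrite scale1r addr0 mul1r.
by rewrite -[X in X = _]addr0 => /addrI.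
Qed.

Let N12 u x y : N u x x y = 0.
Proof. by apply: (alP.2 _ (@Ordinal 4 1 isT) (@Ordinal 4 2 isT)); rewrite ?ffunE. Qed.

Let N23 u x y : N u x y y = 0.
Proof. by apply: (alP.2 _ (@Ordinal 4 2 isT) (@Ordinal 4 3 isT)); rewrite ?ffunE. Qed.

Let d4_alt01 x c d e : d4 x x c d e = 0.
Proof. by rewrite /d4 /ext_d4 !lie_alt !(N0, N12, N23); ring. Qed.
Let d4_alt12 x c d e : d4 c x x d e = 0.
Proof. by rewrite /d4 /ext_d4 !lie_alt !(N0, N12, N23); ring. Qed.
Let d4_alt23 x c d e : d4 c d x x e = 0.
Proof. by rewrite /d4 /ext_d4 !lie_alt !(N0, N12, N23); ring. Qed.
Let d4_alt34 x c d e : d4 c d e x x = 0.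
Proof. by rewrite /d4 /ext_d4 !lie_alt !(N0, N12, N23); ring. Qed.

Let alt_swap (f : g -> g -> R) :
  (forall a u v x, f (a *: u + v) x = a * f u x + f v x) ->
  (forall a u v x, f x (a *: u + v) = a * f x u + f x v) ->
  (forall x, f x x = 0) -> forall x y, f x y = - f y x.
Proof.
move=> fl fr f0 x y; have := f0 (1 *: x + y); rewrite fl !fr !f0.
by rewrite !mul1r add0r addr0 => /eqP; rewrite addr_eq0 => /eqP.
Qed.

Let d4_swap12 x y c d e : d4 c x y d e = - d4 c y x d e.
Proof. by apply: (alt_swap (f := fun x y => d4 c x y d e)) => *; rewrite ?d4_lin ?d4_alt12. Qed.
Let d4_swap23 x y c d e : d4 c d x y e = - d4 c d y x e.
Proof. by apply: (alt_swap (f := fun x y => d4 c d x y e)) => *; rewrite ?d4_lin ?d4_alt23. Qed.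
Let d4_swap34 x y c d e : d4 c d e x y = - d4 c d e y x.
Proof. by apply: (alt_swap (f := fun x y => d4 c d e x y)) => *; rewrite ?d4_lin ?d4_alt34. Qed.

(** This reduces closedness to the 21 increasing quintuples of basis vectors. Equal arguments are
    moved to neighbouring slots by adjacent swaps; there each term vanishes or cancels against
    another. *)
Lemma altform_CE_d4 : altform (CE_d al).
Proof.
split=> [X i a u v|X i j ij Xij].
  have upd_inord m w : (m < 5)%N ->
      upd X i w (inord m) = if m == i :> nat then w else X (inord m).
    by move=> m5; rewrite updE -val_eqE /= inordK.
  rewrite !CE_d4 !upd_inord //.
  by case: i {upd_inord} => [[|[|[|[|[|]]]]] ?] //=; rewrite d4_lin.
wlog lt_ij : i j ij Xij / (i < j)%N.
  move=> H; case: (ltngtP i j) => [||/val_inj e]; [exact: H| |by rewrite e eqxx in ij].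
  by apply: H; rewrite 1?eq_sym.
have Xe m (mi : m = i) : X (inord m) = X i by rewrite mi inord_val.
have Xe' m (mi : m = j) : X (inord m) = X i by rewrite mi inord_val.
rewrite CE_d4; case: i j ij lt_ij Xij Xe Xe' => [i ilt] [j jlt] /=.
move: i j ilt jlt => [|[|[|[|[|]]]]] [|[|[|[|[|]]]]] //= ? ? _ _ Xij Xe Xe';
  rewrite (Xe _ erefl) (Xe' _ erefl).
- exact: d4_alt01.
- by rewrite d4_swap12 d4_alt01 oppr0.
- by rewrite d4_swap23 d4_swap12 d4_alt01 !oppr0.
- by rewrite d4_swap34 d4_swap23 d4_swap12 d4_alt01 !oppr0.
- exact: d4_alt12.
- by rewrite d4_swap23 d4_alt12 oppr0.
- by rewrite d4_swap34 d4_swap23 d4_alt12 !oppr0.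
- exact: d4_alt23.
- by rewrite d4_swap34 d4_alt23 oppr0.
- exact: d4_alt34.
Qed.

Lemma CE_d_vecs (x0 x1 x2 x3 x4 : g) :
  CE_d al (vecs 5 [:: x0; x1; x2; x3; x4]) =
  ext_d4 (fun x y z t u : g => N (br x y) z t u) x0 x1 x2 x3 x4.
Proof. by rewrite CE_d4 !ffunE !inordK. Qed.

End FourForm.
End Differential.

(** * Closedness of the dual 4-form from integer structure constants *)

Section Coclosed.
Context (R : realType) (g : lieAlgebra R) (b : 7.-tuple g) (bB : basis_of fullv b).
Context (c : nat -> nat -> nat -> int).

Definition structure_constants n (b : n.-tuple g) :=
  forall i j : 'I_n, br (tnth b i) (tnth b j) = \sum_(k < n) (c i j k)%:~R *: tnth b k.

Definition dstar_coef (l : seq nat) : int :=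
  let T i j x y z := isum 7 (fun k => c i j k * star_coef [:: k; x; y; z]) in
  if l is [:: x0; x1; x2; x3; x4] then ext_d4 T x0 x1 x2 x3 x4 else 0.

Definition coclosed_check :=
  all (fun l => dstar_coef l == 0) (increasing_seqs 5 0 7).

Lemma G2_coclosed_check : structure_constants b -> coclosed_check ->
  G2_coclosed (g2_model b) b.
Proof.
move=> bc /allP c0 X.
have -> : CE_d (@hodge _ _ 3 4 b (g2_model b)) X = CE_d (star_g2_model b) X.
  rewrite /CE_d; apply: eq_bigr => i _; apply: eq_bigr => j _.
  by rewrite (hodge_g2_model bB).
move: X; apply: (altform_increasing_seqs bB) => [|l lP].
  exact: altform_CE_d4 (altform_star_g2_model b).
have /andP[l7 /eqP sl] : all (gtn 7) l && (size l == 5%N).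
  by move: l lP; apply/allP; vm_compute.
have {c0 lP} := c0 l lP.
case: l l7 sl => [|x0 [|x1 [|x2 [|x3 [|x4 [|]]]]]] //= l7 _ /eqP e.
rewrite (_ : bvecs b 5 _ = vecs 5 [:: b`_x0; b`_x1; b`_x2; b`_x3; b`_x4]); last first.
  by apply/ffunP => i; rewrite !ffunE; case: i => [[|[|[|[|[|]]]]]].
rewrite CE_d_vecs.
have T_eq i j x y z : (i < 7)%N -> (j < 7)%N -> all (gtn 7) [:: x; y; z] ->
    star_g2_model b (vecs 4 [:: br b`_i b`_j; b`_x; b`_y; b`_z]) =
    (isum 7 (fun k => c i j k * star_coef [:: k; x; y; z]))%:~R.
  move=> i7 j7 xyz7.
  have := bc (Ordinal i7) (Ordinal j7); rewrite !(tnth_nth 0) => -> /=.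
  rewrite (_ : vecs 4 _ = upd (bvecs b 4 [:: 0; x; y; z]%N) (@Ordinal 4 0 isT)
    (\sum_(k < 7) (c i j k)%:~R *: tnth b k)); last first.
    by apply/ffunP => q; rewrite !ffunE; case: q => [[|[|[|[|]]]]].
  rewrite (altform_upd_sum (altform_star_g2_model b)) isumE; apply: eq_bigr => k _.
  rewrite (altform_updZ (altform_star_g2_model b)) rmorphM /=; congr (_ * _).
  rewrite -(star_g2_model_bvecs bB) //=; last by rewrite ltn_ord.
  congr (star_g2_model b); apply/ffunP => q; rewrite !ffunE (tnth_nth 0).
  by case: q => [[|[|[|[|]]]]].
case/and5P: l7 => h0 h1 h2 h3 /andP[h4 _].
have := congr1 (fun z : int => z%:~R : R) e; rewrite mulr0z => <-.
rewrite ext_d4_intr.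
by rewrite /ext_d4 !T_eq /= ?h0 ?h1 ?h2 ?h3 ?h4.
Qed.

End Coclosed.

(** * Levi-Civita connection and Ricci curvature *)

Section LinearOnBasis.
Context (R : fieldType) (V W : vectType R) (n : nat) (b : n.-tuple V).
Context (bB : basis_of fullv b).

Lemma eq_linear_basis (F H : V -> W) : linear F -> linear H ->
  (forall i, F (tnth b i) = H (tnth b i)) -> F =1 H.
Proof.
move=> Fl Hl FH x.
have at0 (f : V -> W) : linear f -> f 0 = 0.
  by move=> fl; have := fl (-1) 0 0; rewrite scaler0 addr0 scaleN1r addNr.
rewrite (coord_basis bB (memvf x)); elim/big_ind: _ => [|u v Hu Hv|i _].
- by rewrite !at0.
- by rewrite -[u]scale1r Fl Hl Hu Hv.
by rewrite -[X in F X]addr0 -[X in H X]addr0 Fl Hl !at0 // -(tnth_nth 0) FH.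
Qed.

Lemma eq_bilinear_basis (F H : V -> V -> W) :
  (forall y, linear (F^~ y)) -> (forall x, linear (F x)) ->
  (forall y, linear (H^~ y)) -> (forall x, linear (H x)) ->
  (forall i j, F (tnth b i) (tnth b j) = H (tnth b i) (tnth b j)) -> F =2 H.
Proof.
move=> Fl Fr Hl Hr FH x y.
apply: (eq_linear_basis (F := F^~ y) (H := H^~ y)) => // i.
exact: eq_linear_basis.
Qed.

End LinearOnBasis.

Section Curvature.
Context (R : realType) (g : lieAlgebra R).

(** Independence of the basis: expand each vector of [vbasis] in [b], exchange the sums, and
    recognise the expansion of [f (tnth b j)] in [vbasis]. *)
Lemma trace_basis n (b : n.-tuple g) (f : g -> g) : basis_of fullv b -> linear f ->
  trace f = \sum_i coord b i (f (tnth b i)).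
Proof.
move=> bB fl.
have f_sum (F : 'I_n -> R) : f (\sum_j F j *: tnth b j) = \sum_j F j *: f (tnth b j).
  have f0 : f 0 = 0 by have := fl (-1) 0 0; rewrite scaler0 addr0 scaleN1r addNr.
  elim/big_rec2: _ => [//|j u v _ <-]; exact: fl.
rewrite /trace; set B := vbasis _.
have BB : basis_of {:g} B := vbasisP _.
transitivity (\sum_i \sum_j coord b j (tnth B i) * coord B i (f (tnth b j))).
  apply: eq_bigr => i _; rewrite [in LHS](coord_basis bB (memvf (tnth B i))).
  under eq_bigr => j _ do rewrite -(tnth_nth 0).
  by rewrite f_sum linear_sum; apply: eq_bigr => j _; rewrite linearZ.
rewrite exchange_big; apply: eq_bigr => j _ /=.
rewrite [X in coord b j X](coord_basis BB (memvf (f (tnth b j)))) linear_sum /=.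
by apply: eq_bigr => i _; rewrite linearZ /= mulrC -(tnth_nth 0).
Qed.

Section Nabla.
Context (nabla : {bilinear g -> g -> g}).

Let lin3 (a : R) (A B C D E F : g) :
  a *: A + B - (a *: C + D) - (a *: E + F) = a *: (A - C - E) + (B - D - F).
Proof. by rewrite !opprD [X in X + _]addrACA -scalerBr addrACA -scalerBr. Qed.

Lemma curvature_linear1 y z : linear (fun x => curvature nabla x y z).
Proof. by move=> a u v; rewrite /curvature !(linearPl, linearPr) lin3. Qed.

Lemma curvature_linear2 x z : linear (fun y => curvature nabla x y z).
Proof. by move=> a u v; rewrite /curvature !(linearPl, linearPr) lin3. Qed.

Lemma curvature_linear3 x y : linear (curvature nabla x y).
Proof. by move=> a u v; rewrite /curvature !(linearPl, linearPr) lin3. Qed.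

Lemma trace_linear (F : g -> g -> g) : (forall x, linear (F x)) ->
  scalar (fun y => trace (F^~ y)).
Proof.
move=> Fl a u v; rewrite /trace mulr_sumr -big_split; apply: eq_bigr => i _.
by rewrite /= Fl linearP.
Qed.

Lemma ricci_linear1 z : scalar (fun y => ricci_tensor nabla y z).
Proof. by apply: trace_linear => x; apply: curvature_linear2. Qed.

Lemma ricci_linear2 y : scalar (ricci_tensor nabla y).
Proof. by apply: trace_linear => x; apply: curvature_linear3. Qed.

End Nabla.

Context (n : nat) (b : n.-tuple g) (bB : basis_of fullv b).
Local Notation q := (coframe_metric b).

Lemma coframe_metricC x y : q x y = q y x.
Proof. by apply: eq_bigr => i _; rewrite mulrC. Qed.

Lemma coframe_metricP a u v y : q (a *: u + v) y = a * q u y + q v y.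
Proof.
rewrite /coframe_metric mulr_sumr -big_split; apply: eq_bigr => i _ /=.
by rewrite linearP mulrDl mulrA.
Qed.

Lemma coframe_metricZ a u y : q (a *: u) y = a * q u y.
Proof.
rewrite /coframe_metric mulr_sumr; apply: eq_bigr => i _ /=.
by rewrite linearZ mulrA.
Qed.

Lemma coframe_metricD u v y : q (u + v) y = q u y + q v y.
Proof. by rewrite -[u]scale1r coframe_metricP mul1r scale1r. Qed.

Lemma coframe_metric_sum (I : finType) (F : I -> g) y :
  q (\sum_i F i) y = \sum_i q (F i) y.
Proof.
elim/big_rec2: _ => [|i x z _ <-]; last exact: coframe_metricD.
by rewrite -[0](scale0r 0) coframe_metricZ mul0r.
Qed.

Lemma coord_tnth i j : coord b i (tnth b j) = (i == j)%:R.
Proof. by rewrite (tnth_nth 0) coord_free ?(basis_free bB) // eq_sym. Qed.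

Lemma coframe_metric_basis i x : q (tnth b i) x = coord b i x.
Proof.
rewrite /coframe_metric (bigD1 i) //= big1 ?addr0 => [|j ji].
  by rewrite coord_tnth eqxx mul1r.
by rewrite coord_tnth (negPf ji) mul0r.
Qed.

Lemma coframe_metric_inner_product : inner_product q.
Proof.
split=> [|x y|x x0]; last 1 first.
- have [i xi] : exists i, coord b i x != 0.
    apply/existsP; apply: contraR x0; rewrite negb_exists => /forallP x0.
    rewrite (coord_basis bB (memvf x)) big1 // => i _.
    by have := x0 i; rewrite negbK => /eqP ->; rewrite scale0r.
  rewrite /coframe_metric (bigD1 i) //= ltr_pwDl ?sumr_ge0 //.
    by rewrite -expr2 exprn_even_gt0.
  by move=> j _; rewrite -expr2 sqr_ge0.
- by split=> [y|x] a u v /=; rewrite ?coframe_metricP // coframe_metricC coframe_metricP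
    !(coframe_metricC x).
exact: coframe_metricC.
Qed.

(* Koszul's formula for left-invariant fields:
   2 q(nabla_x y, e) = q([x, y], e) + q(y, [e, x]) + q(x, [e, y]). *)
Definition koszul (x y : g) : g :=
  2^-1 *: (br x y + \sum_k (q (br (tnth b k) x) y + q (br (tnth b k) y) x) *: tnth b k).

Let koszul_bilinear : bilinear_for *:%R *:%R koszul.
Proof.
have lin a (A B : g) (F G : 'I_n -> R) :
    2^-1 *: (a *: A + B + \sum_k (a * F k + G k) *: tnth b k) =
    a *: (2^-1 *: (A + \sum_k F k *: tnth b k)) +
    2^-1 *: (B + \sum_k G k *: tnth b k).
  rewrite scalerA (mulrC a) -scalerA -scalerDr [a *: (A + _)]scalerDr.
  rewrite addrACA scaler_sumr -big_split.
  by congr (_ *: (_ + _)); apply: eq_bigr => k _; rewrite scalerDl scalerA.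
split=> [y|x] a u v; rewrite /koszul ?linearPl ?linearPr -lin; congr (_ *: (_ + _));
  apply: eq_bigr => k _; congr (_ *: _).
  rewrite linearPr coframe_metricP (coframe_metricC _ (_ + _)) coframe_metricP.
  by rewrite !(coframe_metricC _ (br _ _)); ring.
rewrite linearPr coframe_metricP (coframe_metricC _ (_ + _)) coframe_metricP.
by rewrite !(coframe_metricC _ (br _ _)); ring.
Qed.

HB.instance Definition _ := bilinear_isBilinear.Build R g g g *:%R *:%R koszul koszul_bilinear.

Lemma koszul_metric x y z :
  q (koszul x y) z = 2^-1 * (q (br x y) z + (q (br z x) y + q (br z y) x)).
Proof.
rewrite coframe_metricZ coframe_metricD coframe_metric_sum; congr (_ * (_ + _)).
have -> u v w : q (br w u) v = \sum_k coord b k w * q (br (tnth b k) u) v.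
  rewrite {1}(coord_basis bB (memvf w)) linear_sumlz coframe_metric_sum.
  by apply: eq_bigr => k _; rewrite linearZl_LR coframe_metricZ -(tnth_nth 0).
rewrite [q (br z y) x](_ : _ = \sum_k coord b k z * q (br (tnth b k) y) x); last first.
  rewrite {1}(coord_basis bB (memvf z)) linear_sumlz coframe_metric_sum.
  by apply: eq_bigr => k _; rewrite linearZl_LR coframe_metricZ -(tnth_nth 0).
rewrite -big_split; apply: eq_bigr => k _ /=.
by rewrite coframe_metricZ coframe_metric_basis; ring.
Qed.

Lemma koszul_levi_civita : levi_civita q koszul.
Proof.
split=> [x y|x y z].
  rewrite /= /koszul -scalerBr (lie_anti x y).
  rewrite [X in _ - (_ + X)](eq_bigr (fun k =>
    (q (br (tnth b k) x) y + q (br (tnth b k) y) x) *: tnth b k)) => [|k _].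
    rewrite opprD opprK addrACA subrr addr0 -mulr2n -scaler_nat scalerA.
    by rewrite mulVf ?scale1r ?pnatr_eq0.
  by rewrite addrC.
have qN u v : q (- u) v = - q u v by rewrite -scaleN1r coframe_metricZ mulN1r.
rewrite /= [q y _]coframe_metricC !koszul_metric.
by rewrite (lie_anti x z) (lie_anti y z) (lie_anti x y) !qN; ring.
Qed.

End Curvature.

(** * Nilsolitons from integer structure constants *)

Section RicciCheck.
Context (c : nat -> nat -> nat -> int) (n : nat).

Definition koszul_coef i j k : int := c i j k + c k i j + c k j i.

(* Four times the components of the Ricci tensor in the orthonormal frame. *)
Definition ricci_coef j k : int :=
  isum n (fun i => isum n (fun l =>
    koszul_coef j k l * koszul_coef i l i - koszul_coef i k l * koszul_coef j l i
    - (c i j l * koszul_coef l k i) *+ 2)).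

(* Ric is diagonal and Ric - (mu / 4) I is a derivation. *)
Definition nilsoliton_check (mu : int) : bool :=
  all (fun i => all (fun j =>
    (if i == j then true else ricci_coef i j == 0) &&
    all (fun k => if c i j k == 0 then true else
        ricci_coef i i + ricci_coef j j == ricci_coef k k + mu)
      (iota 0 n)) (iota 0 n)) (iota 0 n).

Context (R : realType) (g : lieAlgebra R).
Context (b : n.-tuple g) (bB : basis_of fullv b) (bc : structure_constants c b).
Local Notation q := (coframe_metric b).
Local Notation nabla := (koszul b : {bilinear g -> g -> g}).
Local Notation e := (tnth b).

Lemma coord_bracket i j k : coord b k (br (e i) (e j)) = (c i j k)%:~R.
Proof.
rewrite bc linear_sum (bigD1 k) //= big1 ?addr0 => [|l lk].
  by rewrite linearZ /= coord_tnth // eqxx mulr1.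
by rewrite linearZ /= coord_tnth // eq_sym (negPf lk) mulr0.
Qed.

Lemma koszul_basis i j :
  koszul b (e i) (e j) = \sum_(k < n) (2^-1 * (koszul_coef i j k)%:~R) *: e k.
Proof.
rewrite {1}(coord_basis bB (memvf (koszul _ _ _))); apply: eq_bigr => k _.
rewrite -(tnth_nth 0) -coframe_metric_basis // coframe_metricC koszul_metric //.
rewrite !(coframe_metricC _ _ (e _)) !coframe_metric_basis // !coord_bracket.
by rewrite !intrD !addrA.
Qed.

Lemma ricci_basis j k : ricci_tensor nabla (e j) (e k) = 4^-1 * (ricci_coef j k)%:~R.
Proof.
rewrite /ricci_tensor (trace_basis bB); last exact: curvature_linear1.
rewrite isumE mulr_sumr; apply: eq_bigr => i _.
rewrite /curvature isumE mulr_sumr !linearB /=.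
have ck a l : coord b i (koszul b (e a) (e l)) = 2^-1 * (koszul_coef a l i)%:~R.
  rewrite koszul_basis linear_sum (bigD1 i) //= big1 ?addr0 => [|m mi].
    by rewrite linearZ /= coord_tnth // eqxx mulr1.
  by rewrite linearZ /= coord_tnth // eq_sym (negPf mi) mulr0.
have nr a u : coord b i (koszul b (e a) (\sum_l u l *: e l)) =
    \sum_l u l * (2^-1 * (koszul_coef a l i)%:~R).
  rewrite linear_sumr linear_sum; apply: eq_bigr => l _.
  by rewrite linearZr_LR -ck; apply: linearZ.
have nl a u : coord b i (koszul b (\sum_l u l *: e l) (e a)) =
    \sum_l u l * (2^-1 * (koszul_coef l a i)%:~R).
  rewrite linear_sumlz linear_sum; apply: eq_bigr => l _.
  by rewrite linearZl_LR -ck; apply: linearZ.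
rewrite !(koszul_basis _ k) bc !nr nl -!sumrB; apply: eq_bigr => l _.
rewrite !(intrB, intrM, intrD, mulr2n); by field.
Qed.

Definition diag_map (r : 'I_n -> R) (x : g) : g := \sum_i (r i * coord b i x) *: e i.

Let diag_map_linear r : linear (diag_map r).
Proof.
move=> a u v; rewrite /diag_map scaler_sumr -big_split; apply: eq_bigr => i _ /=.
by rewrite linearP scalerA -scalerDl /=; congr (_ *: _); ring.
Qed.

HB.instance Definition _ r := GRing.isLinear.Build R g g *:%R (diag_map r) (diag_map_linear r).

Lemma diag_map_basis r i : diag_map r (e i) = r i *: e i.
Proof.
rewrite /diag_map (bigD1 i) //= big1 ?addr0 => [|j ji]; rewrite coord_tnth //.
  by rewrite eqxx mulr1.
by rewrite (negPf ji) mulr0 scale0r.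
Qed.

(** A diagonal map with eigenvalues d_i is a derivation when d_i + d_j = d_k whenever b_k occurs in
    the bracket of b_i and b_j. For d_i = r_i - la this reads r_i + r_j = r_k + la. *)
Lemma nilsoliton_of_check mu : nilsoliton_check mu -> nilsoliton q.
Proof.
move=> chk; split; first exact: coframe_metric_inner_product.
have chkP (i j : 'I_n) : (if i == j :> nat then true else ricci_coef i j == 0) &&
    all (fun k => if c i j k == 0 then true else
      ricci_coef i i + ricci_coef j j == ricci_coef k k + mu) (iota 0 n).
  have io (l : 'I_n) : val l \in iota 0 n by rewrite mem_iota /=.
  exact: (allP (allP chk _ (io i)) _ (io j)).
pose r (i : 'I_n) : R := 4^-1 * (ricci_coef i i)%:~R.
pose la : R := 4^-1 * mu%:~R.
exists (linfun (diag_map r)), la, (linfun (diag_map (fun i => r i - la))); split.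
- exists nabla; split; first exact: koszul_levi_civita.
  move=> y z; rewrite lfunE /=.
  apply: (@eq_bilinear_basis _ _ R^o _ _ bB (fun y z => q (diag_map r y) z)
    (ricci_tensor nabla)) => [{}z|{}y|{}z|{}y|i j].
  + by move=> a u v; rewrite linearP coframe_metricP.
  + by move=> a u v; rewrite !(coframe_metricC _ (diag_map _ _)) coframe_metricP.
  + exact: ricci_linear1.
  + exact: ricci_linear2.
  rewrite diag_map_basis coframe_metricZ coframe_metric_basis // coord_tnth // ricci_basis.
  case: (eqVneq j i) => [->|ji]; first by rewrite mulr1.
  have /andP[+ _] := chkP i j; rewrite val_eqE eq_sym (negPf ji) => /eqP ->.
  by rewrite !mulr0.
- move=> x y; rewrite !lfunE /=; set D := diag_map _.
  apply: (@eq_bilinear_basis _ _ g _ _ bB (fun x y => D (br x y))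
    (fun x y => br (D x) y + br x (D y))) => [{}y|{}x|{}y|{}x|i j].
  + by move=> a u v; rewrite linearPl /D linearP.
  + by move=> a u v; rewrite linearPr /D linearP.
  + by move=> a u v; rewrite /D linearP !linearPl /= addrACA -scalerDr.
  + by move=> a u v; rewrite linearPr /D linearP linearPr /= addrACA -scalerDr.
  rewrite /D !diag_map_basis linearZl_LR linearZr_LR -scalerDl bc scaler_sumr linear_sum.
  apply: eq_bigr => k _; rewrite linearZ /= diag_map_basis !scalerA; congr (_ *: _).
  have /andP[_ /allP/(_ (val k))] := chkP i j; rewrite mem_iota => /(_ (ltn_ord k)).
  case: eqP => [->|_ /eqP/(congr1 (fun z : int => z%:~R : R))]; first by rewrite mulr0 mul0r.
  rewrite !intrD => h; rewrite mulrC /r /la; congr (_ * _).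
  apply/eqP; rewrite -subr_eq0 -(subrr (4^-1 * ((ricci_coef k k)%:~R + mu%:~R))) -{2}h.
  by apply/eqP; field.
apply/lfunP => x; rewrite !lfunE /= !lfunE /= id_lfunE [in X in X + _](coord_basis bB (memvf x)).
rewrite scaler_sumr /diag_map -big_split; apply: eq_bigr => i _ /=.
by rewrite -(tnth_nth 0) scalerA -scalerDl; congr (_ *: _); ring.
Qed.

End RicciCheck.

(** * The seven models *)

(* An entry (i, j, k, s) says that [b_i, b_j] has coefficient s on b_k, with
   0-based indices in the adapted frame b. *)
Definition brackets_table := seq (nat * nat * nat * int).

Definition table_constant (L : brackets_table) (i j k : nat) : int :=
  foldr (fun e a => (if e.1 == (i, j, k) then e.2 else
                     if e.1 == (j, i, k) then - e.2 else 0) + a) 0 L.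

(** Put omega = e^12 + e^34 + e^56 and Omega = (e^1 + i e^2)(e^3 + i e^4)(e^5 + i e^6). The 4-form
    is omega^2 / 2 + Im Omega /\ e^7, and b_6 is dual to e^7. For h3 and h5 only e^7 is not closed,
    and its differential, a combination of e^12 and e^34, has type (1,1), hence is annihilated by Im
    Omega. In [table_h3h3], [table_jordan] and [table_h3C] the differential of e^7 still has type
    (1,1); in [table_L58] the differentials of e^3456 and e^1457 cancel. *)
Definition table_h3 : brackets_table := [:: (0, 1, 6, 1%Z)]%N.
Definition table_h5 : brackets_table := [:: (0, 1, 6, 1%Z); (2, 3, 6, 1%Z)]%N.
(* L58 is the algebra (0,0,0,12,13), called L_(5,8) in de Graaf's list. *)
Definition table_L58 : brackets_table := [:: (1, 0, 5, 1%Z); (1, 2, 6, 1%Z)]%N.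
(* b_5 and b_6 are half the difference and half the sum of the brackets spanning the
   centers of the two copies of h3: no signed permutation of a frame adapted to
   the decomposition h3 + h3 + R makes the 4-form closed. *)
Definition table_h3h3 : brackets_table :=
  [:: (0, 1, 6, 1%Z); (0, 1, 5, 1%Z); (2, 3, 6, 1%Z); (2, 3, 5, (-1)%Z)]%N.
Definition table_jordan : brackets_table := [:: (0, 1, 6, 1%Z); (2, 3, 6, 1%Z); (2, 1, 5, 1%Z)]%N.
Definition table_h3C : brackets_table :=
  [:: (0, 3, 5, 1%Z); (0, 2, 6, 1%Z); (1, 3, 6, 1%Z); (1, 2, 5, (-1)%Z)]%N.
Definition table_free : brackets_table := [:: (0, 1, 4, 1%Z); (1, 2, 5, 1%Z); (0, 2, 6, 1%Z)]%N.

Definition table_check L mu :=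
  coclosed_check (table_constant L) && nilsoliton_check (table_constant L) 7 mu.

(** The last argument is 4 lambda, forced by any nonzero bracket. For h3, four times the Ricci
    eigenvalues of b_0, b_1, b_6 are -2, -2, 2, and -2 - 2 - 2 = -6. *)
Lemma check_h3 : table_check table_h3 (-6). Proof. by vm_compute. Qed.
Lemma check_h5 : table_check table_h5 (-8). Proof. by vm_compute. Qed.
Lemma check_L58 : table_check table_L58 (-8). Proof. by vm_compute. Qed.
Lemma check_h3h3 : table_check table_h3h3 (-12). Proof. by vm_compute. Qed.
Lemma check_jordan : table_check table_jordan (-10). Proof. by vm_compute. Qed.
Lemma check_h3C : table_check table_h3C (-12). Proof. by vm_compute. Qed.
Lemma check_free : table_check table_free (-10). Proof. by vm_compute. Qed.

Definition coclosed_nilsoliton (R : realType) (g : lieAlgebra R) : Prop :=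
  exists (phi : kform g 3) (b : 7.-tuple g),
    [/\ G2_adapted phi b, G2_coclosed phi b & nilsoliton (coframe_metric b)].

Lemma coclosed_nilsoliton_of_table (R : realType) (g : lieAlgebra R) L mu (b : 7.-tuple g) :
  table_check L mu -> basis_of fullv b -> structure_constants (table_constant L) b ->
  coclosed_nilsoliton g.
Proof.
case/andP=> cL nL bB bc; exists (g2_model b), b; split.
- by split=> //; apply: altform_g2_model.
- exact: G2_coclosed_check cL.
exact: nilsoliton_of_check nL.
Qed.

(** * Center, derived algebra and adapted bases *)

Section TwoStep.
Context (R : realType) (g : lieAlgebra R).

Definition center : {vspace g} :=
  (\bigcap_(i < \dim {:g}) lker (linfun (br (tnth (vbasis {:g}) i))))%VS.

Definition derived : {vspace g} :=
  (\sum_(i < \dim {:g}) limg (linfun (br (tnth (vbasis {:g}) i))))%VS.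

Lemma centerP x : reflect (forall y, br y x = 0) (x \in center).
Proof.
apply: (iffP idP) => [xZ y|x0].
  apply: (eq_linear_basis (vbasisP {:g}) (F := br^~ x) (H := fun=> 0)) => [||i].
  - by move=> a u v; rewrite linearPl.
  - by move=> a u v; rewrite scaler0 addr0.
  move: xZ; rewrite memvE => /subv_bigcapP/(_ i isT).
  by rewrite -memvE memv_ker lfunE => /eqP.
rewrite memvE; apply/subv_bigcapP => i _.
by rewrite -memvE memv_ker lfunE /= x0.
Qed.

Lemma center_br x y : x \in center -> br x y = 0.
Proof. by move/centerP/(_ y) => xy; rewrite lie_anti xy oppr0. Qed.

Lemma br_center x y : y \in center -> br x y = 0.
Proof. by move/centerP/(_ x). Qed.

Lemma mem_derived x y : br x y \in derived.
Proof.
rewrite (coord_basis (vbasisP {:g}) (memvf x)) linear_sumlz.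
apply: memv_suml => i _; rewrite linearZl_LR memvZ //.
apply: (subvP (sumv_sup i _ (subvv _))) => //.
by rewrite -(tnth_nth 0) -[br _ y](lfunE (br (tnth (vbasis {:g}) i))) memv_img ?memvf.
Qed.

Lemma derived_sub (V : {vspace g}) : (forall x y, br x y \in V) -> (derived <= V)%VS.
Proof.
move=> xyV; apply/subv_sumP => i _; apply/subvP => z /memv_imgP[u _ ->].
by rewrite lfunE; apply: xyV.
Qed.

Section Assembly.
Context (dim7 : \dim {:g} = 7%N) (L : brackets_table).
Context (r k : nat) (X : r.-tuple g) (Y : k.-tuple g).
Local Notation t := (table_constant L).

Definition table_shape : bool :=
  all (fun e : nat * nat * nat * int =>
    [&& e.1.1.1 != e.1.1.2, e.1.1.1 < r, e.1.1.2 < r & 7 - k <= e.1.2])%N L.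

(* Every X_i has, for some j and l, a nonzero Y_l-component of [X_i, X_j]
   which the other X_i' lack; hence no combination of X is central. *)
Definition table_separated : bool :=
  all (fun i => has (fun j => has (fun l =>
    all (fun i' => (t i' j l != 0) == (i' == i)) (iota 0 r))
    (iota (7 - k) k)) (iota 0 r)) (iota 0 r).

Context (shapeL : table_shape) (sepL : table_separated).
Context (freeY : free Y).
Context (XY : forall i j, (i < j < r)%N ->
  br X`_i X`_j = \sum_(l < k) (t i j (7 - k + l))%:~R *: Y`_l).

Lemma table_constantC i j l : t i j l = - t j i l.
Proof.
move: shapeL; rewrite /table_shape /table_constant; elim: L => [|e L' IH] /=.
  by rewrite oppr0.
case/andP=> /and4P[e12 _ _ _] /IH ->; rewrite opprD; congr (_ + _).
case: eqP => [e1|_]; last by case: eqP => _; rewrite ?opprK ?oppr0.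
case: eqP => [e2|_]; last by rewrite opprK.
by move: e12; rewrite e1 /=; move: e2; rewrite e1 => -[-> _]; rewrite eqxx.
Qed.

Lemma table_constant_support i j l :
  ~~ [&& i < r, j < r & 7 - k <= l]%N -> t i j l = 0.
Proof.
move: shapeL; rewrite /table_shape /table_constant.
elim: L => [|e L' IH] //= /andP[/and4P[_ e1 e2 e3] /IH{}IH] h; rewrite IH // addr0.
case: eqP => [ee|_]; first by rewrite ee /= in e1 e2 e3; rewrite e1 e2 e3 in h.
by case: eqP => [ee|//]; rewrite ee /= in e1 e2 e3; rewrite e1 e2 e3 in h.
Qed.

Lemma table_constant0 i l : t i i l = 0.
Proof.
by have /eqP := table_constantC i i l; rewrite -addr_eq0 -mulr2n mulrn_eq0 => /eqP.
Qed.

Lemma XY_all i j : (i < r)%N -> (j < r)%N ->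
  br X`_i X`_j = \sum_(l < k) (t i j (7 - k + l))%:~R *: Y`_l.
Proof.
move=> ir jr; case: (ltngtP i j) => [ij|ji|<-].
- by apply: XY; rewrite ij.
- rewrite lie_anti XY ?ji // -sumrN; apply: eq_bigr => l _.
  by rewrite (table_constantC i) rmorphN scaleNr.
by rewrite lie_alt big1 // => l _; rewrite table_constant0 scale0r.
Qed.

Lemma central_combination (u : 'I_r -> R) :
  \sum_i u i *: X`_i \in center -> forall i, u i = 0.
Proof.
move=> uZ i; have ii : val i \in iota 0 r by rewrite mem_iota /=.
have /hasP[j jr /hasP[l lk /allP sep]] := allP sepL _ ii.
move: jr lk; rewrite !mem_iota /= add0n => jr /andP[lk1 lk2].
have lk : (l - (7 - k) < k)%N by rewrite ltn_subLR.
have /eqP := center_br X`_j uZ; rewrite linear_sumlz.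
rewrite (eq_bigr (fun i : 'I_r =>
    \sum_(l < k) (u i * (t i j (7 - k + l))%:~R) *: Y`_l)); last first.
  move=> i' _; rewrite linearZl_LR XY_all // scaler_sumr.
  by apply: eq_bigr => l' _; rewrite scalerA.
rewrite exchange_big /=; under eq_bigr => l' _ do rewrite -scaler_suml.
have /freeP fY := freeY; move/eqP/fY/(_ (Ordinal lk)) => /=; rewrite subnKC //.
rewrite (bigD1 i) //= big1 ?addr0 => [/eqP|i' i'i].
  have := sep _ ii; rewrite eqxx => /eqP tl; rewrite mulf_eq0 intr_eq0 (negPf tl).
  by rewrite orbF => /eqP.
have := sep (val i'); rewrite mem_iota /= ltn_ord => /(_ isT).
by rewrite val_eqE (negPf i'i) => /eqP/negbFE/eqP ->; rewrite mulr0.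
Qed.

(** No nontrivial combination of [X] is central. Besides building frames, the bound serves to rule
    out configurations with too many generators. *)
Lemma dim_center_le : (r + \dim center <= 7)%N /\ directv (<<X>> + center) /\ free X.
Proof.
have fX : free X.
  apply/freeP => u u0; apply: central_combination.
  by rewrite u0 mem0v.
have dX : directv (<<X>> + center).
  apply/directv_addP/eqP; rewrite -subv0.
  apply/subvP => v; rewrite memv_cap => /andP[vX vZ].
  rewrite (coord_span vX) in vZ; rewrite memv0 (coord_span vX) big1 // => i _.
  by rewrite (central_combination vZ) scale0r.
split; last by split.
rewrite -dim7 -(size_tuple X) -(eqP (fX : _ == _)) -(directvP dX) /=.
exact: dimvS (subvf _).
Qed.

(** By dimension, [X] and the center fill g. The frame is [X ++ T ++ Y] with [T] a basis of a
    complement of the span of [Y] in the center, so that [Y] occupies the last [k] positions, where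
    the table expects the brackets. *)
Lemma table_basis : (7 <= r + \dim center)%N -> {subset Y <= center} ->
  exists b : 7.-tuple g, basis_of fullv b /\ structure_constants t b.
Proof.
move=> r7 YZ; have [_ [dX fX]] := dim_center_le.
have X_basis : basis_of <<X>> X by rewrite /basis_of eqxx.
have Y_basis : basis_of <<Y>> Y by rewrite /basis_of eqxx.
have YsubZ : (<<Y>> <= center)%VS by apply/span_subvP.
pose T := vbasis (center :\: <<Y>>).
have Z_basis : basis_of center (T ++ Y).
  have ZE : (center :\: <<Y>> + <<Y>>)%VS = center by rewrite addv_diff; apply/addv_idPl.
  rewrite -[X in basis_of X _]ZE; apply: cat_basis => //; last exact: vbasisP.
  by apply/directv_addP; apply: capv_diff.
have full : (<<X>> + center)%VS = fullv.
  apply/eqP; rewrite eqEdim subvf (directvP dX) /= dim7.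
  by rewrite (eqP (fX : _ == _)) size_tuple.
have bB : basis_of fullv (X ++ T ++ Y) by rewrite -full; apply: cat_basis.
have size_b : size (X ++ T ++ Y) == 7%N.
  by have := size_basis (X := in_tuple (X ++ T ++ Y)) bB; rewrite dim7 => <-.
exists (Tuple size_b); split=> // i j; rewrite !(tnth_nth 0) /=.
have size_XT : size (X ++ T) = (7 - k)%N.
  by rewrite -(eqP size_b) catA [size (_ ++ Y)]size_cat [size Y]size_tuple addnK.
have nthX i' : (i' < r)%N -> (X ++ T ++ Y)`_i' = X`_i'.
  by move=> ir; rewrite nth_cat size_tuple ir.
have nthZ i' : (r <= i')%N -> (X ++ T ++ Y)`_i' \in center.
  move=> ri; have [i7|i7] := ltnP i' 7%N; last by rewrite nth_default ?mem0v // (eqP size_b).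
  rewrite nth_cat size_tuple ltnNge ri /=; apply: (basis_mem Z_basis).
  apply: mem_nth; move/eqP: size_b; rewrite size_cat size_tuple => size_b.
  by rewrite -(ltn_add2l r) subnKC // size_b.
have [ri|ir] := leqP r i.
  rewrite center_br ?nthZ // big1 // => l _.
  by rewrite table_constant_support ?scale0r // ltnNge ri.
have [rj|jr] := leqP r j.
  rewrite br_center ?nthZ // big1 // => l _.
  by rewrite table_constant_support ?scale0r // (ltnNge j) rj andbF.
have k7 : (k <= 7)%N by rewrite -(eqP size_b) catA size_cat [size Y]size_tuple leq_addl.
rewrite !nthX // XY_all //.
under [RHS]eq_bigr => l _ do rewrite (tnth_nth 0) /=.
rewrite -(big_mkord xpredT (fun l => (t i j l)%:~R *: (X ++ T ++ Y)`_l)).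
rewrite (big_cat_nat (n := 7 - k)) ?leq_subr //= [X in X + _]big_nat_cond [X in X + _]big1 => [|l].
  rewrite add0r -[X in \sum_(X <= _ < _) _]add0n big_addn subKn // big_mkord.
  apply: eq_bigr => l _; rewrite catA nth_cat size_XT.
  by rewrite ltnNge leq_addl /= addnK addnC.
rewrite andbT /= => lk; rewrite table_constant_support ?scale0r //.
by rewrite (leqNgt (7 - k)) lk !andbF.
Qed.

End Assembly.
End TwoStep.

(** * Combinations of two vectors and complements *)

Section Pairs.
Context (R : realType) (V : vectType R).
Implicit Types u v w z : V.

Lemma free2P u v :
  reflect (forall a b, a *: u + b *: v = 0 -> a = 0 /\ b = 0) (free [:: u; v]).
Proof.
apply: (iffP (freeP (X := [tuple u; v]))) => [h a b ab0|h k].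
  have := h (fun i => [tuple a; b]`_i); rewrite !big_ord_recl big_ord0 addr0 /= => /(_ ab0) h'.
  by split; [apply: (h' ord0) | apply: (h' (lift ord0 ord0))].
rewrite !big_ord_recl big_ord0 addr0 /= => /h[k0 k1] i.
by case: (unliftP ord0 i) => [j ->|-> //]; rewrite (ord1 j).
Qed.

Lemma span2P u v w : w \in <<[:: u; v]>>%VS -> exists a b, w = a *: u + b *: v.
Proof.
rewrite span_cons span_seq1 => /memv_addP[_ /vlineP[a ->] [_ /vlineP[b ->] ->]].
by exists a, b.
Qed.

(** Kept folded, so that [congr comb2] turns an identity between brackets into two scalar identities
    for [field] or [ring]. *)
Definition comb2 u v (a b : R) : V := a *: u + b *: v.

Lemma comb2D u v a b c d : comb2 u v a b + comb2 u v c d = comb2 u v (a + c) (b + d).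
Proof. by rewrite /comb2 addrACA !scalerDl. Qed.

Lemma comb2N u v a b : - comb2 u v a b = comb2 u v (- a) (- b).
Proof. by rewrite /comb2 opprD !scaleNr. Qed.

Lemma comb2Z u v c a b : c *: comb2 u v a b = comb2 u v (c * a) (c * b).
Proof. by rewrite /comb2 scalerDr !scalerA. Qed.

Lemma comb2_0 u v : comb2 u v 0 0 = 0.
Proof. by rewrite /comb2 !scale0r addr0. Qed.

Lemma comb2_l u v : comb2 u v 1 0 = u.
Proof. by rewrite /comb2 scale1r scale0r addr0. Qed.

Lemma comb2_r u v : comb2 u v 0 1 = v.
Proof. by rewrite /comb2 scale1r scale0r add0r. Qed.

Lemma free_comb2 u v a b c d : a * d - b * c != 0 ->
  free [:: u; v] -> free [:: comb2 u v a b; comb2 u v c d].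
Proof.
move=> det0 /free2P uv; apply/free2P => s t.
rewrite !comb2Z comb2D => /uv[h1 h2].
have hs : s * (a * d - b * c) = d * (s * a + t * c) - c * (s * b + t * d) by ring.
have ht : t * (a * d - b * c) = a * (s * b + t * d) - b * (s * a + t * c) by ring.
move: hs ht; rewrite h1 h2 !mulr0 subrr => /eqP + /eqP.
by rewrite !mulf_eq0 (negPf det0) !orbF => /eqP -> /eqP ->.
Qed.

Lemma span_complement (U W : {vspace V}) m : (U <= W)%VS -> (\dim W <= \dim U + m)%N ->
  exists w : m.-tuple V, (U + <<w>>)%VS = W.
Proof.
move=> UW dimW; pose B := vbasis (W :\: U).
have sB : (\dim (W :\: U) <= m)%N.
  have := dimv_cap_compl W U; rewrite (capv_idPr UW) => dimE.
  by move: dimW; rewrite -dimE leq_add2l.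
(* If the complement has dimension less than [m], the default value of [nth] pads the tuple with
   zeros. *)
exists [tuple B`_i | i < m]; apply/eqP; rewrite eqEsubv; apply/andP; split.
  rewrite subv_add UW; apply/span_subvP => _ /mapP[i _ ->].
  have [iB|iB] := ltnP i (size B); last by rewrite nth_default ?mem0v.
  exact: (subvP (diffvSl W U) _ (vbasis_mem (mem_nth 0 iB))).
rewrite -[X in (X <= _)%VS](addv_idPl UW) -addv_diff addvC addvS //.
rewrite -[X in (X <= _)%VS](span_basis (vbasisP (W :\: U))).
apply/span_subvP => _ /(nthP 0)[i iB <-].
rewrite size_tuple in iB; apply: memv_span; apply/mapP.
by exists (Ordinal (leq_trans iB sB)); rewrite ?mem_enum.
Qed.

End Pairs.

Lemma forall_lt2 (P : nat -> nat -> Prop) :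
  P 0%N 1%N -> forall i j, (i < j < 2)%N -> P i j.
Proof. by move=> ? i [|[|j]] /andP[ij //]; case: i ij. Qed.

Lemma forall_lt3 (P : nat -> nat -> Prop) :
  P 0%N 1%N -> P 0%N 2%N -> P 1%N 2%N -> forall i j, (i < j < 3)%N -> P i j.
Proof. by move=> ? ? ? i [|[|[|j]]] /andP[ij //]; case: i ij => [|[|i]]. Qed.

Lemma forall_lt4 (P : nat -> nat -> Prop) :
  P 0%N 1%N -> P 0%N 2%N -> P 0%N 3%N -> P 1%N 2%N -> P 1%N 3%N -> P 2%N 3%N ->
  forall i j, (i < j < 4)%N -> P i j.
Proof.
by move=> ? ? ? ? ? ? i [|[|[|[|j]]]] /andP[ij //]; case: i ij => [|[|[|i]]].
Qed.

(** [Posz 0], [Posz 1] and [Negz 0] are the forms in which [vm_compute] leaves the entries 0, 1 and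
    -1. *)
Lemma table_scale (R : pzRingType) (V : lmodType R) (v : V) :
  ((Posz 0)%:~R *: v = 0) * ((Posz 1)%:~R *: v = v) * ((Negz 0)%:~R *: v = - v).
Proof. by rewrite scale0r scale1r scaleN1r. Qed.

Ltac eval_table :=
  rewrite ?big_ord_recl big_ord0 /=;
  repeat match goal with |- context [table_constant ?L ?i ?j ?k] =>
    let v := eval vm_compute in (table_constant L i j k) in
    rewrite (_ : table_constant L i j k = v); last by []
  end; rewrite !table_scale ?(addr0, add0r).

(** * Generators modulo the center *)

Section NormalForms.
Context (R : realType) (g : lieAlgebra R).
Context (dim7 : \dim {:g} = 7%N) (nil : forall x y z : g, br x (br y z) = 0).
Local Notation Z := (center g).

Lemma derived_center : (derived g <= Z)%VS.
Proof. by apply: derived_sub => x y; apply/centerP => z. Qed.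

Lemma bracket_center x y : br x y \in Z.
Proof. exact: subvP derived_center _ (mem_derived x y). Qed.

Lemma coclosed_of_brackets L mu r k (X : r.-tuple g) (Y : k.-tuple g) :
  table_check L mu -> table_shape L r k -> table_separated L r k -> free Y ->
  {subset Y <= Z} ->
  (forall i j, (i < j < r)%N ->
     br X`_i X`_j = \sum_(l < k) (table_constant L i j (7 - k + l))%:~R *: Y`_l) ->
  (7 <= r + \dim Z)%N -> coclosed_nilsoliton g.
Proof.
move=> chk sh sep fY YZ XY r7.
have [b [bB bc]] := table_basis dim7 sh sep fY XY r7 YZ.
exact: coclosed_nilsoliton_of_table chk bB bc.
Qed.

Lemma span_mod_center (w : seq g) :
  (forall v, exists2 s, s \in <<w>>%VS & v - s \in Z) -> (Z + <<w>>)%VS = fullv.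
Proof.
move=> h; apply/eqP; rewrite eqEsubv subvf; apply/subvP => v _.
by have [s sw vs] := h v; rewrite -(subrK s v) memv_add.
Qed.

Lemma span_mod_centerP (w : seq g) v : (Z + <<w>>)%VS = fullv ->
  exists2 s, s \in <<w>>%VS & v - s \in Z.
Proof.
move=> full; have := memvf v; rewrite -full => /memv_addP[z zZ [s sw ->]].
by exists s; rewrite ?addrK.
Qed.

Lemma dim_mod_center (w : seq g) : (Z + <<w>>)%VS = fullv -> (7 <= size w + \dim Z)%N.
Proof.
move=> full; rewrite -dim7 -full (leq_trans (dimv_add_leqif _ _)) // addnC.
by rewrite leq_add2r dim_span.
Qed.

Lemma br_span (w : seq g) (U : {vspace g}) : (forall x y, x \in w -> y \in w -> br x y \in U) ->
  forall x y, x \in <<w>>%VS -> y \in <<w>>%VS -> br x y \in U.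
Proof.
move=> wU x y; rewrite -[w]/(tval (in_tuple w)) => /coord_span -> /coord_span ->.
rewrite linear_sumlz memv_suml // => i _; rewrite linear_sumr memv_suml // => j _.
by rewrite linearZl_LR linearZr_LR !memvZ // wU // mem_nth.
Qed.

Lemma derived_sub_span (w : seq g) (U : {vspace g}) : (Z + <<w>>)%VS = fullv ->
  (forall x y, x \in w -> y \in w -> br x y \in U) -> (derived g <= U)%VS.
Proof.
move=> full wU; apply: derived_sub => x y.
have [s sw xs] := span_mod_centerP x full; have [s' sw' ys] := span_mod_centerP y full.
rewrite -(subrK s x) -(subrK s' y) linearDl (center_br _ xs) add0r linearDr.
by rewrite (br_center _ ys) add0r (br_span wU).
Qed.

Lemma center_span (w : seq g) x : (Z + <<w>>)%VS = fullv ->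
  (forall y, y \in w -> br y x = 0) -> x \in Z.
Proof.
move=> full wx; apply/centerP => y.
have [s sw ys] := span_mod_centerP y full.
rewrite -(subrK s y) linearDl (center_br _ ys) add0r.
move: sw; rewrite -[w]/(tval (in_tuple w)) => /coord_span ->.
by rewrite linear_sumlz big1 // => i _; rewrite linearZl_LR wx ?scaler0 ?mem_nth.
Qed.

Lemma coclosed_derived3 : (3 <= \dim (derived g))%N -> (4 <= \dim Z)%N ->
  coclosed_nilsoliton g.
Proof.
move=> d3 z4.
have [w full] : exists w : 3.-tuple g, (Z + <<w>>)%VS = fullv.
  by apply: span_complement; rewrite ?subvf // dim7 (leq_add z4).
pose Y := [tuple br w`_0 w`_1; br w`_1 w`_2; br w`_0 w`_2].
have dY : (derived g <= <<Y>>)%VS.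
  apply: derived_sub_span full _ => x y /tnthP[i ->] /tnthP[j ->].
  have mem_br p q : (p < q < 3)%N -> br w`_p w`_q \in <<Y>>%VS.
    by move: p q; apply: forall_lt3; apply: memv_span; rewrite !inE eqxx ?orbT.
  rewrite !(tnth_nth 0); case: (ltngtP i j) => [ij|ji|->].
  - by rewrite mem_br ?ij /=.
  - by rewrite lie_anti memvN mem_br ?ji /=.
  by rewrite lie_alt mem0v.
have fY : free Y.
  rewrite /free eqn_leq dim_span size_tuple (leq_trans d3) //; exact: dimvS.
have r7 : (7 <= 3 + \dim Z)%N by rewrite (leq_add2l 3 4).
apply: (coclosed_of_brackets (X := w) check_free _ _ fY _ _ r7) => //.
- by move=> y; rewrite !inE => /or3P[] /eqP->; apply: bracket_center.
by apply: forall_lt3; eval_table.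
Qed.

End NormalForms.

(** * Normal forms *)

Section SmallDerived.
Context (R : realType) (g : lieAlgebra R).
Context (dim7 : \dim {:g} = 7%N) (nil : forall x y z : g, br x (br y z) = 0).
Local Notation Z := (center g).

Let bracketsZ (s : seq g) : all (fun v => v \in Z) s -> {subset s <= Z}.
Proof. by move/allP. Qed.

Lemma coclosed_h3 (x y : g) : br x y != 0 -> (5 <= \dim Z)%N -> coclosed_nilsoliton g.
Proof.
move=> z0 z5; have r7 : (7 <= 2 + \dim Z)%N by rewrite (leq_add2l 2 5).
have fY : free [tuple br x y] by rewrite seq1_free.
apply: (coclosed_of_brackets dim7 (X := [tuple x; y]) check_h3 _ _ fY _ _ r7) => //.
  by apply: bracketsZ; rewrite /= bracket_center.
by apply: forall_lt2; eval_table.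
Qed.

Lemma coclosed_h5 (x y p q : g) :
  br x y != 0 -> br p q = br x y -> br x p = 0 -> br x q = 0 -> br y p = 0 -> br y q = 0 ->
  (3 <= \dim Z)%N -> coclosed_nilsoliton g.
Proof.
move=> z0 pq xp xq yp yq z3; have r7 : (7 <= 4 + \dim Z)%N by rewrite (leq_add2l 4 3).
have fY : free [tuple br x y] by rewrite seq1_free.
apply: (coclosed_of_brackets dim7 (X := [tuple x; y; p; q]) check_h5 _ _ fY _ _ r7) => //.
  by apply: bracketsZ; rewrite /= bracket_center.
by apply: forall_lt4; eval_table.
Qed.

Lemma coclosed_L58 (a x b : g) :
  free [:: br x a; br x b] -> br a b = 0 -> (4 <= \dim Z)%N -> coclosed_nilsoliton g.
Proof.
move=> fY ab z4; have r7 : (7 <= 3 + \dim Z)%N by rewrite (leq_add2l 3 4).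
apply: (coclosed_of_brackets dim7 (X := [tuple a; x; b]) (Y := [tuple br x a; br x b])
  check_L58 _ _ fY _ _ r7) => //.
  by apply: bracketsZ; rewrite /= !bracket_center.
by apply: forall_lt3; eval_table; rewrite // lie_anti.
Qed.

Lemma coclosed_h3h3 (x y p q : g) :
  free [:: br x y; br p q] -> br x p = 0 -> br x q = 0 -> br y p = 0 -> br y q = 0 ->
  (3 <= \dim Z)%N -> coclosed_nilsoliton g.
Proof.
move=> f xp xq yp yq z3; have r7 : (7 <= 4 + \dim Z)%N by rewrite (leq_add2l 4 3).
pose c := comb2 (br x y) (br p q).
have fY : free [:: c 2^-1 (- 2^-1); c 2^-1 2^-1].
  apply: free_comb2 f; rewrite (_ : _ - _ = 2^-1); last by field.
  by rewrite invr_eq0 pnatr_eq0.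
apply: (coclosed_of_brackets dim7 (X := [tuple x; y; p; q])
  (Y := [tuple c 2^-1 (- 2^-1); c 2^-1 2^-1]) check_h3h3 _ _ fY _ _ r7) => //.
  by apply: bracketsZ; rewrite /= /c /comb2 !memvD ?memvZ ?bracket_center.
apply: forall_lt4; eval_table; rewrite // /c ?comb2N comb2D.
  by rewrite -{1}[br x y](comb2_l _ (br p q)); congr comb2; field.
by rewrite -{1}[br p q](comb2_r (br x y)); congr comb2; field.
Qed.

Lemma coclosed_jordan (u y x v : g) :
  free [:: br x y; br x v] -> br u y = br x v -> br u x = 0 -> br u v = 0 -> br y v = 0 ->
  (3 <= \dim Z)%N -> coclosed_nilsoliton g.
Proof.
move=> fY uy ux uv yv z3; have r7 : (7 <= 4 + \dim Z)%N by rewrite (leq_add2l 4 3).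
apply: (coclosed_of_brackets dim7 (X := [tuple u; y; x; v]) (Y := [tuple br x y; br x v])
  check_jordan _ _ fY _ _ r7) => //.
  by apply: bracketsZ; rewrite /= !bracket_center.
by apply: forall_lt4; eval_table; rewrite // lie_anti.
Qed.

Lemma coclosed_h3C (x u v y : g) :
  free [:: br x y; br x v] -> br u y = br x v -> br u v = - br x y ->
  br x u = 0 -> br v y = 0 ->
  (3 <= \dim Z)%N -> coclosed_nilsoliton g.
Proof.
move=> fY uy uv xu vy z3; have r7 : (7 <= 4 + \dim Z)%N by rewrite (leq_add2l 4 3).
apply: (coclosed_of_brackets dim7 (X := [tuple x; u; v; y]) (Y := [tuple br x y; br x v])
  check_h3C _ _ fY _ _ r7) => //.
  by apply: bracketsZ; rewrite /= !bracket_center.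
by apply: forall_lt4; eval_table.
Qed.

(** * Symplectic reduction for a one-dimensional derived algebra *)

Lemma br_span0 (w : seq g) x : (forall a, a \in w -> br a x = 0) ->
  forall s, s \in <<w>>%VS -> br s x = 0.
Proof.
move=> wx s; rewrite -[w]/(tval (in_tuple w)) => /coord_span ->.
by rewrite linear_sumlz big1 // => i _; rewrite linearZl_LR wx ?scaler0 ?mem_nth.
Qed.

(** The analogue of an orthogonal splitting along a nondegenerate subspace: g is the sum of the span
    of [w] and the centralizer of [w]. *)
Definition reduces (w : seq g) := forall v,
  exists2 s, s \in <<w>>%VS & forall a, a \in w -> br a (v - s) = 0.

(** When the centralizer of [w] is abelian, [v - s] commutes both with it and with [w], hence with
    everything. *)
Lemma reduces_full (w : seq g) : reduces w ->
  (forall u v, (forall a, a \in w -> br a u = 0) -> (forall a, a \in w -> br a v = 0) ->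
    br u v = 0) ->
  (Z + <<w>>)%VS = fullv.
Proof.
move=> red comm; apply: span_mod_center => v.
have [s sw vs] := red v; exists s => //; apply/centerP => u.
have [s' sw' us] := red u.
by rewrite -(subrK s' u) linearDl (comm (u - s')) // (br_span0 vs sw') addr0.
Qed.

Lemma reduces_pair (x y : g) : br x y != 0 ->
  (forall u v : g, exists a, br u v = a *: br x y) -> reduces [:: x; y].
Proof.
move=> z0 derived_z v; have [a xv] := derived_z x v; have [b yv] := derived_z y v.
(* Projection onto a hyperbolic plane: this vector has the same brackets with [x] and [y] as [v]. *)
exists (a *: y - b *: x).
  by rewrite memvB // memvZ // memv_span // !inE eqxx ?orbT.
move=> _ /[!inE]/orP[] /eqP->; rewrite !linearBr !linearZr_LR lie_alt /=.
  by rewrite xv scaler0 subr0 subrr.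
by rewrite (lie_anti x y) yv scalerN scaler0 opprK add0r subrr.
Qed.

Lemma reduces_cat (w w' : seq g) : reduces w -> reduces w' ->
  (forall a a', a \in w -> a' \in w' -> br a a' = 0) -> reduces (w ++ w').
Proof.
move=> red red' ww' v; have [s sw vs] := red v; have [s' sw' vs'] := red' (v - s).
exists (s + s').
  by rewrite span_cat memv_add.
move=> a; rewrite mem_cat opprD addrA => /orP[aw|aw']; last exact: vs'.
rewrite linearBr vs // sub0r lie_anti opprK; apply: br_span0 sw' => a' aw'.
by rewrite lie_anti ww' ?oppr0.
Qed.

(** The table of the seven-dimensional Heisenberg algebra, which serves only to exclude it through
    [dim_center_le]. *)
Lemma table_h3_sum3 : table_shape [:: (0, 1, 6, 1%Z); (2, 3, 6, 1%Z); (4, 5, 6, 1%Z)]%N 6 1 &&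
  table_separated [:: (0, 1, 6, 1%Z); (2, 3, 6, 1%Z); (4, 5, 6, 1%Z)]%N 6 1.
Proof. by vm_compute. Qed.

Lemma coclosed_derived1 (x y : g) : br x y != 0 ->
  (forall u v : g, exists a, br u v = a *: br x y) -> (2 <= \dim Z)%N ->
  coclosed_nilsoliton g.
Proof.
move=> z0 derived_z z2.
have scale u v : br u v != 0 -> exists c, br u (c *: v) = br x y.
  have [a uv] := derived_z u v; rewrite uv scaler_eq0 negb_or => /andP[a0 _].
  by exists a^-1; rewrite linearZr_LR uv scalerA mulVf // scale1r.
have red_pair u v : br u v = br x y -> reduces [:: u; v].
  by move=> uv; apply: reduces_pair; rewrite uv.
pose comm (w : seq g) u := forall a, a \in w -> br a u = 0.
have commZ w u c : comm w u -> comm w (c *: u).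
  by move=> wu a aw; rewrite linearZr_LR wu ?scaler0.
(* Either the centralizer of [w] is abelian, or it contains a further pair, rescaled to have bracket
   exactly [br x y]. *)
have dichotomy w : (forall u v, comm w u -> comm w v -> br u v = 0) \/
    exists u v, [/\ comm w u, comm w v & br u v = br x y].
  have [?|] := pselect (forall u v, comm w u -> comm w v -> br u v = 0); first by left.
  move=> /existsNP[u /existsNP[v /not_implyP[wu /not_implyP[wv /eqP uv]]]].
  by have [c ucv] := scale _ _ uv; right; exists u, (c *: v); split=> //; apply: commZ.
have r1 := red_pair x y erefl.
have [c1|[p [q [wp wq pq]]]] := dichotomy [:: x; y].
  apply: (coclosed_h3 z0).
  by have := dim_mod_center dim7 (reduces_full r1 c1); rewrite (leq_add2l 2 5).
have xp : br x p = 0 by apply: wp; rewrite !inE eqxx ?orbT.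
have yp : br y p = 0 by apply: wp; rewrite !inE eqxx ?orbT.
have xq : br x q = 0 by apply: wq; rewrite !inE eqxx ?orbT.
have yq : br y q = 0 by apply: wq; rewrite !inE eqxx ?orbT.
have r2 : reduces [:: x; y; p; q].
  apply: (reduces_cat r1 (red_pair p q pq)) => a a' + /[!inE]/orP[] /eqP->; last exact: wq.
  exact: wp.
have [c2|[u [v [wu wv uv]]]] := dichotomy [:: x; y; p; q].
  apply: (coclosed_h5 z0 pq) => //.
  by have := dim_mod_center dim7 (reduces_full r2 c2); rewrite (leq_add2l 4 3).
(* A third pair would give six vectors independent modulo the center, against dim Z >= 2. *)
have [sh sep] := andP table_h3_sum3.
have fY : free [tuple br x y] by rewrite seq1_free.
have [] := dim_center_le dim7 (X := [tuple x; y; p; q; u; v]) sh sep fY.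
  move=> i [|[|[|[|[|[|j]]]]]] /andP[ij j6] //; case: i ij => [|[|[|[|[|i]]]]] //= _;
    eval_table => //; by [apply: wu; rewrite !inE eqxx ?orbT | apply: wv; rewrite !inE eqxx ?orbT].
by rewrite -[7%N]/(6 + 1)%N leq_add2l leqNgt z2.
Qed.

End SmallDerived.

(** * Two-dimensional derived algebra *)

Section Derived2.
Context (R : realType) (g : lieAlgebra R).
Context (dim7 : \dim {:g} = 7%N) (nil : forall x y z : g, br x (br y z) = 0).
Local Notation Z := (center g).

Let brE :=
  ((fun x y z : g => linearDl (@lie R g) z x y : br (x + y) z = br x z + br y z),
   (fun x y z : g => linearDr (@lie R g) x y z : br x (y + z) = br x y + br x z),
   (fun x y : g => linearNl (@lie R g) y x : br (- x) y = - br x y),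
   (fun x y : g => linearNr (@lie R g) x y : br x (- y) = - br x y),
   (fun a (x y : g) => linearZl_LR (@lie R g) y a x : br (a *: x) y = a *: br x y),
   (fun a (x y : g) => linearZr_LR (@lie R g) x a y : br x (a *: y) = a *: br x y)).

Lemma free2_line (V : vectType R) (u v : V) : u != 0 -> free [:: u; v] = (v \notin <[u]>%VS).
Proof.
move=> u0; rewrite (perm_free (_ : perm_eq _ [:: v; u])); last first.
  by rewrite (perm_catC [:: u] [:: v]).
by rewrite free_cons seq1_free u0 andbT span_seq1.
Qed.

(** Suppose every ad x has rank at most 1, and take independent brackets [x, y] and [p, q]. Then
    [p, y] and [x, q] lie on both of their lines, so they vanish, and ad (x + p) sends y and q to
    [x, y] and [p, q], a contradiction. *)
Lemma exists_free_brackets : (2 <= \dim (derived g))%N ->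
  exists x y v : g, free [:: br x y; br x v].
Proof.
move=> d2; apply: contrapT => nofree.
have line (x y v : g) : br x y != 0 -> br x v \in <[br x y]>%VS.
  move=> xy0; apply: contrapT => /negP h; apply: nofree; exists x, y, v.
  by rewrite free2_line.
have [x [y xy0]] : exists x y : g, br x y != 0.
  apply: contrapT => h; suff : (derived g <= 0)%VS by move/dimvS; rewrite dimv0 leqNgt ltnW.
  apply: derived_sub => x y; rewrite memv0; apply: contrapT => /negP xy.
  by apply: h; exists x, y.
have [p [q pq]] : exists p q : g, br p q \notin <[br x y]>%VS.
  apply: contrapT => h; suff /dimvS : (derived g <= <[br x y]>)%VS.
    by rewrite leqNgt (leq_ltn_trans _ d2) // dim_vline leq_b1.
  apply: derived_sub => p q; apply: contrapT => /negP pq.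
  by apply: h; exists p, q.
have pq0 : br p q != 0 by apply: contra pq => /eqP ->; rewrite mem0v.
have zero (v : g) : v \in <[br x y]>%VS -> v \in <[br p q]>%VS -> v = 0.
  move=> vx /vlineP[c vE]; rewrite vE in vx *; case: (eqVneq c 0) => [->|c0].
    by rewrite scale0r.
  by move: pq; rewrite -[br p q](scalerK c0) memvZ.
have lineN (u v w : g) : br v u != 0 -> br u w \in <[br v u]>%VS.
  move=> vu; have := line u v w; rewrite (lie_anti v u) oppr_eq0 => /(_ vu).
  by move=> /vlineP[c ->]; rewrite scalerN memvN memvZ ?memv_line.
apply: nofree; exists (x + p), y, q.
rewrite !linearDl.
have -> : br p y = 0.
  by apply: zero; [rewrite lie_anti memvN lineN | rewrite line].
have -> : br x q = 0.
  by apply: zero; [rewrite line | rewrite lie_anti memvN lineN].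
by rewrite addr0 add0r free2_line.
Qed.

Section Frame.
Context (dim2 : \dim (derived g) = 2%N) (dimZ : (3 <= \dim Z)%N).

Lemma mem_comb2 (z1 z2 u w : g) : free [:: z1; z2] ->
  z1 \in derived g -> z2 \in derived g -> exists a b, br u w = comb2 z1 z2 a b.
Proof.
move=> f d1 d2; suff : br u w \in <<[:: z1; z2]>>%VS by move/span2P.
suff -> : <<[:: z1; z2]>>%VS = derived g by apply: mem_derived.
apply/eqP; rewrite eqEdim dim2 (eqP (f : _ == _)) andbT; apply/span_subvP => s.
by rewrite !inE => /orP[] /eqP->.
Qed.

(** The kernel of ad x has dimension at most 5 and contains Z + <x>, of dimension at least 4, so one
    more vector [u] completes it; [u] may be central. Modulo this kernel g is spanned by [y] and
    [v], since ad x maps them to a basis of the derived algebra. *)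
Lemma centralizer_frame (x y v : g) : free [:: br x y; br x v] ->
  exists2 u, br x u = 0 & (Z + <<[:: x; u; y; v]>>)%VS = fullv.
Proof.
move=> f; pose K := lker (linfun (br x)).
have KP w : (w \in K) = (br x w == 0) by rewrite memv_ker lfunE.
have xK : x \in K by rewrite KP lie_alt.
have sK : (Z + <[x]> <= K)%VS.
  rewrite subv_add; apply/andP; split; last by rewrite -memvE.
  by apply/subvP => w wZ; rewrite KP br_center.
have xZ : x \notin Z.
  apply/negP => xZ; move: f => /free2P/(_ 1 0) [].
    by rewrite scale1r scale0r addr0 center_br.
  by move/eqP; rewrite oner_eq0.
have dK : (\dim K <= \dim (Z + <[x]>) + 1)%N.
  have ltZ : (\dim Z < \dim (Z + <[x]>))%N.
    rewrite ltnNge; apply: contra xZ => dimle.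
    have /eqP -> : Z == (Z + <[x]>)%VS by rewrite eqEdim addvSl.
    exact: subvP (addvSr _ _) _ (memv_line x).
  have dimL : (2 <= \dim (limg (linfun (br x))))%N.
    rewrite -[2%N]/(size [:: br x y; br x v]) -(eqP (f : _ == _)); apply: dimvS.
    apply/span_subvP => s; rewrite !inE => /orP[] /eqP->.
      by rewrite -[br x y](lfunE (br x)) memv_img ?memvf.
    by rewrite -[br x v](lfunE (br x)) memv_img ?memvf.
  have := limg_ker_dim (linfun (br x)) fullv; rewrite capfv dim7 -/K => dimK.
  rewrite -(leq_add2r (\dim (limg (linfun (br x))))) dimK.
  by rewrite -[7%N]/(4 + 1 + 2)%N !leq_add // (leq_ltn_trans dimZ ltZ).
have [w full] := span_complement sK dK.
exists (tnth w ord0).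
  apply/eqP; rewrite -KP -full; apply: subvP (addvSr _ _) _ _.
  by rewrite memv_span ?mem_tnth.
apply: span_mod_center => t; have [a [b xt]] := mem_comb2 x t f (mem_derived _ _) (mem_derived _ _).
have : t - (a *: y + b *: v) \in K.
  by rewrite KP linearBr xt linearDr !linearZr_LR subrr.
rewrite -full => /memv_addP[_ /memv_addP[z zZ [_ /vlineP[c ->] ->]] [s sw tE]].
exists (c *: x + s + (a *: y + b *: v)); last first.
  by rewrite [_ + s + _]addrC opprD addrA tE -[z + _ + s]addrA addrK.
have sub w' : w' \in [:: x; tnth w ord0; y; v] -> w' \in <<[:: x; tnth w ord0; y; v]>>%VS.
  exact: memv_span.
have sS : s \in <<[:: x; tnth w ord0; y; v]>>%VS.
  suff /subvP/(_ s sw) : (<<w>> <= <<[:: x; tnth w ord0; y; v]>>)%VS by [].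
  apply/span_subvP => _ /tnthP[i ->].
  by rewrite (ord1 i) sub // !inE eqxx orbT.
by rewrite !memvD ?memvZ ?sS ?sub ?inE ?eqxx ?orbT.
Qed.

(* The brackets of the frame x, u, y, v (with u commuting with x) are governed by
   the matrix of ad u in the bases (y, v) and ([x, y], [x, v]); here v is in its
   kernel. *)
Lemma coclosed_singular (x u y v : g) : free [:: br x y; br x v] ->
  (Z + <<[:: x; u; y; v]>>)%VS = fullv -> br x u = 0 -> br u v = 0 ->
  coclosed_nilsoliton g.
Proof.
set z1 := br x y; set z2 := br x v => f full xu uv.
have d1 : z1 \in derived g by apply: mem_derived.
have d2 : z2 \in derived g by apply: mem_derived.
have [a [b uy]] := mem_comb2 u y f d1 d2; have [e [h yv]] := mem_comb2 y v f d1 d2.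
have xy : br x y = comb2 z1 z2 1 0 by rewrite comb2_l.
have xv : br x v = comb2 z1 z2 0 1 by rewrite comb2_r.
move: xu uv; rewrite -!(comb2_0 z1 z2) => xu uv.
clearbody z1 z2.
have alt w : br w w = comb2 z1 z2 0 0 by rewrite comb2_0 lie_alt.
have ux := lie_anti x u; have vu := lie_anti u v; have yx := lie_anti x y.
have vx := lie_anti x v; have yu := lie_anti u y; have vy := lie_anti y v.
pose brs := (xu, uv, xy, xv, uy, yv, alt, (ux, vu, yx, vx, yu, vy)).
have [a0|a0] := eqVneq a 0; last first.
  (* Eigenvalues a and 0: under the identification by ad x, ad u1 and ad p are complementary
     idempotents, with kernels spanned by v and y + (b/a) v. The terms with [e] and [h] make the two
     kernel vectors commute. *)
  pose u1 := a^-1 *: u; pose p := x - u1; pose v1 := v + e *: u1.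
  pose y1 := y + (b / a) *: v - (h - e * (b / a)) *: p.
  apply: (coclosed_h3h3 dim7 nil (x := u1) (y := y1) (p := p) (q := v1)) => //;
    rewrite /y1 /v1 /p /u1 !brE !brs !(comb2Z, comb2N, comb2D).
  - rewrite (_ : comb2 _ _ _ _ = comb2 z1 z2 1 (b / a)); last by congr comb2; field.
    rewrite (_ : [:: _; comb2 _ _ _ _] = [:: comb2 z1 z2 1 (b / a); comb2 z1 z2 0 1]); last first.
      by congr [:: _; comb2 _ _ _ _]; field.
    by apply: free_comb2 f; rewrite mulr1 mulr0 subr0 oner_neq0.
  - by rewrite -[RHS](comb2_0 z1 z2); congr comb2; field.
  - by rewrite -[RHS](comb2_0 z1 z2); congr comb2; field.
  - by rewrite -[RHS](comb2_0 z1 z2); congr comb2; field.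
  - by rewrite -[RHS](comb2_0 z1 z2); congr comb2; field.
(* For a = b = 0 the matrix vanishes, so [u] is central and x, y, v generate g modulo the center. *)
have [b0|b0] := eqVneq b 0.
  have uZ : u \in Z.
    apply: (center_span full) => w; rewrite !inE => /or4P[] /eqP->.
    - by rewrite xu comb2_0.
    - exact: lie_alt.
    - by rewrite yu uy a0 b0 comb2_0 oppr0.
    by rewrite vu uv comb2_0 oppr0.
  have full' : (Z + <<[:: x; y; v]>>)%VS = fullv.
    apply/eqP; rewrite eqEsubv subvf -full subv_add addvSl /=.
    apply/span_subvP => w; rewrite !inE => /or4P[] /eqP->.
    - by apply: subvP (addvSr _ _) _ _; rewrite memv_span ?inE ?eqxx ?orbT.
    - exact: subvP (addvSl _ _) _ uZ.
    - by apply: subvP (addvSr _ _) _ _; rewrite memv_span ?inE ?eqxx ?orbT.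
    by apply: subvP (addvSr _ _) _ _; rewrite memv_span ?inE ?eqxx ?orbT.
  have z4 : (4 <= \dim Z)%N by have := dim_mod_center dim7 full'; rewrite (leq_add2l 3 4).
  (* The multiples of [x] cancel [y, v] = e z1 + h z2 and leave the brackets with [x] unchanged. *)
  apply: (coclosed_L58 dim7 nil (a := y - h *: x) (x := x) (b := v + e *: x)) => //;
    rewrite !brE !brs !(comb2Z, comb2N, comb2D).
    rewrite (_ : comb2 _ _ _ _ = z1); last by rewrite -[RHS](comb2_l _ z2); congr comb2; field.
    by rewrite (_ : comb2 _ _ _ _ = z2) // -[RHS](comb2_r z1); congr comb2; field.
  by rewrite -[RHS](comb2_0 z1 z2); congr comb2; field.
(* Nilpotent case: ad u1 sends y to z2 and kills v; adding multiples of [x] and [u1] to [v] makes it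
   commute with [y]. *)
pose u1 := b^-1 *: u; pose v1 := v + e *: x + h *: u1.
have xv1 : br x v1 = z2.
  by rewrite /v1 /u1 !brE !brs !(comb2Z, comb2N, comb2D) -[RHS](comb2_r z1); congr comb2; field.
apply: (coclosed_jordan dim7 nil (u := u1) (y := y) (x := x) (v := v1)) => //.
- by rewrite xv1 xy comb2_l.
- by rewrite xv1 /u1 !brE !brs a0 !(comb2Z, comb2N, comb2D) -[RHS](comb2_r z1); congr comb2; field.
- by rewrite /u1 !brE !brs !(comb2Z, comb2N, comb2D) -[RHS](comb2_0 z1 z2); congr comb2; field.
- by rewrite /v1 /u1 !brE !brs !(comb2Z, comb2N, comb2D) -[RHS](comb2_0 z1 z2); congr comb2; field.
by rewrite /v1 /u1 !brE !brs a0 !(comb2Z, comb2N, comb2D) -[RHS](comb2_0 z1 z2); congr comb2; field.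
Qed.

(** By Cayley-Hamilton a traceless matrix squares to the scalar a^2 + b c, here negative; rescaling
    gives a complex structure. *)
Lemma coclosed_elliptic (x u y v : g) a b c : free [:: br x y; br x v] -> br x u = 0 ->
  br u y = comb2 (br x y) (br x v) a b -> br u v = comb2 (br x y) (br x v) c (- a) ->
  a ^+ 2 + b * c < 0 -> coclosed_nilsoliton g.
Proof.
set z1 := br x y; set z2 := br x v => f xu uy uv neg.
have d1 : z1 \in derived g by apply: mem_derived.
have d2 : z2 \in derived g by apply: mem_derived.
have [e [h yv]] := mem_comb2 y v f d1 d2.
have xy : br x y = comb2 z1 z2 1 0 by rewrite comb2_l.
have xv : br x v = comb2 z1 z2 0 1 by rewrite comb2_r.
move: xu; rewrite -(comb2_0 z1 z2) => xu.
clearbody z1 z2.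
have alt w : br w w = comb2 z1 z2 0 0 by rewrite comb2_0 lie_alt.
have ux := lie_anti x u; have vu := lie_anti u v; have yx := lie_anti x y.
have vx := lie_anti x v; have yu := lie_anti u y; have vy := lie_anti y v.
pose brs := (xu, uv, xy, xv, uy, yv, alt, (ux, vu, yx, vx, yu, vy)).
pose d := Num.sqrt (- (a ^+ 2 + b * c)).
have d_gt0 : 0 < d by rewrite sqrtr_gt0 oppr_gt0.
have d_neq0 : d != 0 by rewrite gt_eqF.
have dE : b * c = - d ^+ 2 - a ^+ 2 by rewrite sqr_sqrtr ?oppr_ge0 ?ltW //; ring.
have b0 : b != 0.
  by apply: contraTN neg => /eqP ->; rewrite mul0r addr0 -leNgt sqr_ge0.
have cE : c = (- d ^+ 2 - a ^+ 2) / b by rewrite -dE; field.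
(* J = ad u / d squares to -1; up to multiples of x and u making it commute with
   y, the vector v1 is such that [x, v1] = J [x, y]. *)
pose u1 := d^-1 *: u.
pose v1 := (a / d) *: y + (b / d) *: v + (b / d * e - h * (a / d)) *: x + h *: u1.
have xv1 : br x v1 = comb2 z1 z2 (a / d) (b / d).
  by rewrite /v1 /u1 !brE !brs !(comb2Z, comb2N, comb2D); congr comb2; field.
apply: (coclosed_h3C dim7 nil (x := x) (u := u1) (v := v1) (y := y)) => //.
- rewrite xv1 xy; apply: free_comb2 f.
  by rewrite mul0r subr0 mul1r mulf_neq0 ?invr_eq0.
- by rewrite xv1 /u1 !brE !brs !comb2Z; congr comb2; field.
- rewrite /v1 /u1 !brE !brs !(comb2Z, comb2N, comb2D) cE.
  by congr comb2; field; rewrite ?d_neq0 ?b0.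
- by rewrite /u1 !brE !brs !comb2Z -[RHS](comb2_0 z1 z2); congr comb2; field.
rewrite /v1 /u1 !brE !brs !(comb2Z, comb2N, comb2D) -[RHS](comb2_0 z1 z2); congr comb2; by field.
Qed.

(* The alternative is between real and complex eigenvalues of ad u on (y, v). *)
Lemma coclosed_derived2 : coclosed_nilsoliton g.
Proof.
have [x [y [v f]]] : exists x y v : g, free [:: br x y; br x v].
  by apply: exists_free_brackets; rewrite dim2.
have [u xu full] := centralizer_frame f.
have d1 := mem_derived x y; have d2 := mem_derived x v.
have [a [b uy]] := mem_comb2 u y f d1 d2; have [c [d uv]] := mem_comb2 u v f d1 d2.
pose shift t := u - t *: x.
have shift_x t : br x (shift t) = 0 by rewrite /shift !brE lie_alt xu scaler0 subrr.
have shift_y t : br (shift t) y = comb2 (br x y) (br x v) (a - t) b.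
  rewrite /shift !brE uy -{2}[br x y](comb2_l _ (br x v)) !(comb2Z, comb2N, comb2D).
  by congr comb2; ring.
have shift_v t : br (shift t) v = comb2 (br x y) (br x v) c (d - t).
  rewrite /shift !brE uv -{2}[br x v](comb2_r (br x y)) !(comb2Z, comb2N, comb2D).
  by congr comb2; ring.
(* A quarter of the discriminant of the characteristic polynomial. Subtracting half the trace times
   [x] from [u] makes the matrix traceless. *)
have [neg|pos] := ltP (((a - d) / 2) ^+ 2 + b * c) 0.
  apply: (coclosed_elliptic (u := shift ((a + d) / 2)) f (shift_x _) _ _ neg).
    by rewrite shift_y; congr comb2; field.
  by rewrite shift_v; congr comb2; field.
(* The larger eigenvalue; replacing [u] by [u - t *: x] makes the matrix singular. *)
pose t := (a + d) / 2 + Num.sqrt (((a - d) / 2) ^+ 2 + b * c).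
have det0 : (a - t) * (d - t) = b * c.
  rewrite (_ : (a - t) * (d - t) = Num.sqrt (((a - d) / 2) ^+ 2 + b * c) ^+ 2 - ((a - d) / 2) ^+ 2).
    by rewrite sqr_sqrtr //; ring.
  by rewrite /t; field.
have full_shift y1 v1 : y \in <<[:: y1; v1]>>%VS -> v \in <<[:: y1; v1]>>%VS ->
    (Z + <<[:: x; shift t; y1; v1]>>)%VS = fullv.
  move=> y_in v_in; apply/eqP; rewrite eqEsubv subvf -full subv_add addvSl /=.
  apply: subv_trans (addvSr _ _); apply/span_subvP => w.
  have sub : (<<[:: y1; v1]>> <= <<[:: x; shift t; y1; v1]>>)%VS.
    by apply/span_subvP => w'; rewrite !inE => /orP[] /eqP->; rewrite memv_span ?inE ?eqxx ?orbT.
  rewrite !inE => /or4P[] /eqP->.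
  - by rewrite memv_span ?inE ?eqxx.
  - by rewrite -(subrK (t *: x) u) memvD ?memvZ ?memv_span ?inE ?eqxx ?orbT.
  - exact: subvP sub _ y_in.
  exact: subvP sub _ v_in.
have in_l (w1 w2 : g) : w1 \in <<[:: w1; w2]>>%VS by rewrite memv_span ?inE ?eqxx.
have in_r (w1 w2 : g) : w2 \in <<[:: w1; w2]>>%VS by rewrite memv_span ?inE ?eqxx ?orbT.
have [/andP[/eqP A0 /eqP B0]|AB] := boolP ((a - t == 0) && (b == 0)).
  apply: (coclosed_singular (x := x) (u := shift t) (y := v) (v := y)) => //.
  - by rewrite (perm_free (_ : perm_eq _ [:: br x y; br x v])) // (perm_catC [:: br x v]).
  - exact: full_shift.
  by rewrite shift_y A0 B0 comb2_0.
(* The first column of the singular matrix is nonzero, so the second is a multiple of it and s y + v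
   spans the kernel. *)
have [s [s1 s2]] : exists s, s * (a - t) + c = 0 /\ s * b + (d - t) = 0.
  have [A0|A0] := eqVneq (a - t) 0.
    have b0 : b != 0 by move: AB; rewrite A0 eqxx.
    have c0 : c = 0.
      by apply/eqP; move: det0; rewrite A0 mul0r => /esym/eqP; rewrite mulf_eq0 (negPf b0).
    by exists (- (d - t) / b); rewrite A0 c0; split; field.
  exists (- c / (a - t)); split; first by field.
  rewrite (_ : _ + _ = ((a - t) * (d - t) - b * c) / (a - t)); last by field.
  by rewrite det0 subrr mul0r.
have xv1 : br x (s *: y + v) = comb2 (br x y) (br x v) s 1.
  by rewrite !brE /comb2 scale1r.
apply: (coclosed_singular (x := x) (u := shift t) (y := y) (v := s *: y + v)) => //.
- rewrite xv1 -[X in [:: X; _]](comb2_l _ (br x v)); apply: free_comb2 f.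
  by rewrite mul1r mul0r subr0 oner_neq0.
- by apply: full_shift => //; rewrite -[v in v \in _](addKr (s *: y)) memvD ?memvN ?memvZ.
by rewrite linearDr linearZr_LR shift_y shift_v /= comb2Z comb2D s1 s2 comb2_0.
Qed.

End Frame.
End Derived2.

(** * Decomposable algebras *)

Section Decomposable.
Context (R : realType) (g : lieAlgebra R).
Context (dim7 : \dim {:g} = 7%N) (nil : forall x y z : g, br x (br y z) = 0).
Local Notation Z := (center g).

Lemma heisenberg_free (x y : g) : br x y != 0 -> free [:: x; y; br x y].
Proof.
move=> z0; apply/(freeP (X := [tuple x; y; br x y])) => k.
rewrite !big_ord_recl big_ord0 addr0 /= => k0.
have k1 : k (lift ord0 ord0) = 0.
  have := congr1 (br x) k0; rewrite !linearDr !linearZr_LR lie_alt nil linear0r /=.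
  by rewrite !scaler0 add0r addr0 => /eqP; rewrite scaler_eq0 (negPf z0) orbF => /eqP.
have k2 : k ord0 = 0.
  have := congr1 (br y) k0; rewrite !linearDr !linearZr_LR lie_alt nil linear0r lie_anti /=.
  by rewrite !scaler0 !addr0 => /eqP; rewrite scaler_eq0 oppr_eq0 (negPf z0) orbF => /eqP.
move: k0; rewrite k1 k2 !scale0r !add0r => /eqP; rewrite scaler_eq0 (negPf z0) orbF => /eqP k3.
by case=> -[|[|[|//]]] i3; [rewrite -k2 | rewrite -k1 | rewrite -k3]; congr k; apply: val_inj.
Qed.

Section Ideals.
Context (I J : {vspace g}) (idI : lie_ideal I) (idJ : lie_ideal J).
Context (full : (I + J)%VS = fullv) (direct : directv (I + J)).

Let IJ0 t : t \in I -> t \in J -> t = 0.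
Proof.
move=> tI tJ; have := directv_addP direct => IJ.
by apply/eqP; rewrite -memv0 -IJ memv_cap tI tJ.
Qed.

Let brIJ i j : i \in I -> j \in J -> br i j = 0.
Proof.
move=> iI jJ; apply: IJ0; last exact: idJ.
by rewrite lie_anti memvN idI.
Qed.

Let split_br u v : exists i i' j j', [/\ i \in I, i' \in I, j \in J, j' \in J &
  br u v = br i i' + br j j'].
Proof.
have := memvf u; have := memvf v; rewrite -full.
move=> /memv_addP[i' i'I [j' j'J ->]] /memv_addP[i iI [j jJ ->]].
exists i, i', j, j'; split=> //; rewrite linearDl !linearDr (brIJ iI j'J) addr0.
by rewrite (lie_anti i' j) (brIJ i'I jJ) oppr0 add0r.
Qed.

(** An abelian summand [I] is central, while all brackets lie in [J], which meets [I] in 0. *)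
Lemma noncommutator_abelian : I != 0%VS -> (forall x y, x \in I -> y \in I -> br x y = 0) ->
  exists2 t, t \in Z & t \notin derived g.
Proof.
rewrite -vpick0 => I0 abI; exists (vpick I).
  apply/centerP => v; have := memvf v; rewrite -full => /memv_addP[i iI [j jJ ->]].
  rewrite linearDl abI ?memv_pick // add0r lie_anti brIJ ?oppr0 ?memv_pick //.
apply: contra I0 => tD; apply/eqP/IJ0; first exact: memv_pick.
apply: subvP tD; apply: derived_sub => u v.
have [i [i' [j [j' [iI i'I jJ j'J ->]]]]] := split_br u v.
by rewrite abI // add0r idJ.
Qed.

(** Here [J] is h3 + R: a fourth vector [w], corrected by multiples of [x] and [y], becomes a
    central [t]. The derived algebra lies in I + <z>, which does not contain [t]. *)
Lemma noncommutator_dim4 (x y : g) : \dim J = 4%N -> x \in J -> y \in J -> br x y != 0 ->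
  exists2 t, t \in Z & t \notin derived g.
Proof.
move=> dJ xJ yJ; set z := br x y => z0.
have zJ : z \in J by apply: idJ.
have f := heisenberg_free z0.
have sub : (<<[:: x; y; z]>> <= J)%VS.
  by apply/span_subvP => s; rewrite !inE => /or3P[] /eqP->.
have dU : \dim <<[:: x; y; z]>>%VS = 3%N by apply/eqP; apply: f.
have [w1 JE] : exists w : 1.-tuple g, (<<[:: x; y; z]>> + <<w>>)%VS = J.
  by apply: span_complement; rewrite ?dU ?dJ.
have [w w1E] : exists w, w1 = [:: w] :> seq g.
  by case: w1 {JE} => -[|w [|]] //; exists w.
move: JE; rewrite w1E => JE {w1E w1}.
have wJ : w \in J by rewrite -JE (subvP (addvSr _ _)) // memv_span ?inE.
have wU : w \notin <<[:: x; y; z]>>%VS.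
  apply/negP => wU; suff : (J <= <<[:: x; y; z]>>)%VS by move/dimvS; rewrite dU dJ.
  by rewrite -JE subv_add subvv; apply/span_subvP => s; rewrite inE => /eqP->.
have JP s : s \in J -> exists a b c d, s = a *: x + b *: y + c *: z + d *: w.
  rewrite -JE !span_cons span_nil !addv0 => /memv_addP[r + [_ /vlineP[d ->] ->]].
  move=> /memv_addP[_ /vlineP[a ->] [r' /memv_addP[_ /vlineP[b ->] [_ /vlineP[c ->] ->]] ->]].
  by exists a, b, c, d; rewrite !addrA.
have xz : br x z = 0 by apply: nil.
have yz : br y z = 0 by apply: nil.
(* Write [p, w] = a x + b y + c z + d w. If d is nonzero, bracketing with [p] expresses [p, w]
   through [p, a x + b y], a multiple of [z]. If d = 0, bracketing with [x] and [y] gives b = a =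
   0. *)
have line p : (p == x) || (p == y) -> br p w \in <[z]>%VS.
  move=> pxy; have pJ : br p w \in J by apply: idJ.
  have pxyz a b : br p (a *: x + b *: y) \in <[z]>%VS.
    rewrite linearDr !linearZr_LR; case/orP: pxy => /eqP->.
      by rewrite lie_alt scaler0 add0r memvZ ?memv_line.
    by rewrite lie_alt scaler0 addr0 memvZ // lie_anti memvN memv_line.
  have [a [b [c [d pw]]]] := JP _ pJ.
  have [d0|d0] := eqVneq d 0; last first.
    have : br p (br p w) = 0 by apply: nil.
    rewrite {1}pw linearDr (linearDr _ _ _ (c *: z)) !linearZr_LR.
    have -> : br p z = 0 by apply: nil.
    rewrite scaler0 addr0 => /eqP; rewrite addr_eq0 -eqr_oppLR => /eqP pwE.
    by rewrite -(scalerK d0 (br p w)) -pwE memvZ // memvN.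
  rewrite d0 scale0r addr0 in pw.
  have : br x (br p w) = 0 by apply: nil.
  rewrite pw !linearDr !linearZr_LR lie_alt xz !scaler0 add0r addr0 => /eqP.
  rewrite scaler_eq0 (negPf z0) orbF => /eqP b0.
  have : br y (br p w) = 0 by apply: nil.
  rewrite pw !linearDr !linearZr_LR lie_alt yz lie_anti !scaler0 !addr0 => /eqP.
  rewrite scaler_eq0 oppr_eq0 (negPf z0) orbF => /eqP a0.
  by rewrite a0 b0 !scale0r !add0r memvZ ?memv_line.
have /vlineP[be xw] : br x w \in <[z]>%VS by rewrite line ?eqxx.
have /vlineP[al yw] : br y w \in <[z]>%VS by rewrite line ?eqxx ?orbT.
pose t := w - be *: y + al *: x.
have xt : br x t = 0.
  by rewrite /t linearDr linearBr !linearZr_LR lie_alt xw scaler0 addr0 subrr.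
have yt : br y t = 0.
  rewrite /t linearDr linearBr !linearZr_LR lie_alt yw lie_anti.
  by rewrite scaler0 subr0 scalerN subrr.
have tJ : t \in J by rewrite /t memvD ?memvB ?memvZ.
have wE : w = t + be *: y - al *: x by rewrite /t addrAC addrK subrK.
have zt : br z t = 0 by rewrite lie_anti nil oppr0.
clearbody t; have tz : t \notin <[z]>%VS.
  apply: contra wU => tz; have tU : t \in <<[:: x; y; z]>>%VS.
    by case/vlineP: tz => c ->; rewrite memvZ ?memv_span ?inE ?eqxx ?orbT.
  by rewrite wE memvB ?memvD ?tU ?memvZ ?memv_span ?inE ?eqxx ?orbT.
exists t.
  apply/centerP => v; have := memvf v; rewrite -full => /memv_addP[i iI [j jJ ->]].
  rewrite linearDl brIJ // add0r; have [a [b [c [d ->]]]] := JP _ jJ.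
  have wt : br w t = 0.
    by rewrite {1}wE linearBl linearDl !linearZl_LR lie_alt xt yt !scaler0 addr0 subr0.
  by rewrite !linearDl !linearZl_LR xt yt zt wt !scaler0 !addr0.
apply: contra tz => /(subvP (_ : derived g <= I + <[z]>)%VS) tIz.
have : t \in (I + <[z]>)%VS.
  apply: tIz; apply: derived_sub => u v.
  have [i [i' [j [j' [iI i'I jJ j'J ->]]]]] := split_br u v.
  apply: memv_add; first exact: idI.
  have JS : J = <<[:: x; y; z; w]>>%VS.
    by rewrite -JE -span_cat.
  rewrite JS in jJ j'J; apply: br_span jJ j'J => s s'.
  have wx : br w x = - (be *: z) by rewrite lie_anti xw.
  have wy : br w y = - (al *: z) by rewrite lie_anti yw.
  have yx : br y x = - z by rewrite lie_anti.
  have zv v' : br z v' = 0 by rewrite lie_anti nil oppr0.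
  have vz v' : br v' z = 0 by apply: nil.
  rewrite !inE => /or4P[] /eqP-> /or4P[] /eqP->; rewrite ?lie_alt ?zv ?vz ?mem0v //
    -/z ?wx ?wy ?xw ?yw ?yx ?memvN ?memvZ ?memv_line //.
move=> /memv_addP[i iI [_ /vlineP[c ->] tE]].
have i0 : i = 0.
  apply: IJ0 => //; rewrite -(addrK (c *: z) i) -tE memvB ?memvZ //.
by rewrite tE i0 add0r memvZ ?memv_line.
Qed.

End Ideals.
Lemma dim_nonabelian (I : {vspace g}) (x y : g) : lie_ideal I ->
  x \in I -> y \in I -> br x y != 0 -> (3 <= \dim I)%N.
Proof.
move=> idI xI yI /heisenberg_free f; rewrite -(eqP (f : _ == 3%N)) dimvS //.
by apply/span_subvP => s; rewrite !inE => /or3P[] /eqP-> //; apply: idI.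
Qed.

Lemma abelian_dichotomy (I : {vspace g}) :
  (forall x y, x \in I -> y \in I -> br x y = 0) \/
  exists x y : g, [/\ x \in I, y \in I & br x y != 0].
Proof.
have [|] := pselect (forall x y, x \in I -> y \in I -> br x y = 0); first by left.
move=> /existsNP[x /existsNP[y /not_implyP[xI /not_implyP[yI /eqP xy]]]].
by right; exists x, y.
Qed.

(** A central vector outside the derived algebra suffices. If neither summand is abelian, each
    contains a Heisenberg algebra and has dimension at least 3, so one of them has dimension exactly
    4. *)
Lemma dim_derived_lt_center : decomposable g -> (\dim (derived g) < \dim Z)%N.
Proof.
move=> [I [J [[idI idJ] [I0 J0] full direct]]].
have fullC : (J + I)%VS = fullv by rewrite addvC.
have directC : directv (J + I).
  by apply/directv_addP; rewrite capvC; apply/directv_addP.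
suff [t tZ tD] : exists2 t, t \in Z & t \notin derived g.
  rewrite ltnNge; apply: contra tD => dimle.
  by have /eqP -> : derived g == Z by rewrite eqEdim derived_center.
have [abI|[x [y [xI yI xy]]]] := abelian_dichotomy I.
  exact: (noncommutator_abelian idI idJ full direct I0 abI).
have [abJ|[x' [y' [x'J y'J xy']]]] := abelian_dichotomy J.
  exact: (noncommutator_abelian idJ idI fullC directC J0 abJ).
have dI := dim_nonabelian idI xI yI xy; have dJ := dim_nonabelian idJ x'J y'J xy'.
have dIJ : (\dim I + \dim J = 7)%N by rewrite -dim7 -full (directvP direct).
have [dJ4|dJ4] := eqVneq (\dim J) 4%N.
  exact: (noncommutator_dim4 idI idJ full direct dJ4 x'J y'J xy').
have dI4 : \dim I = 4%N by clear -dI dJ dJ4 dIJ; lia.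
exact: (noncommutator_dim4 idJ idI fullC directC dI4 xI yI xy).
Qed.

End Decomposable.

Theorem theorem18 (R : realType) (g : lieAlgebra R)
    (dim7 : \dim {: g} = 7%N)
    (nilp2 : two_step_nilpotent g)
    (decomp : decomposable g) :
  exists (phi : kform g 3) (b : 7.-tuple g),
    [/\ G2_adapted phi b,
        G2_coclosed phi b
      & nilsoliton (coframe_metric b)].
Proof.
have [nonab nil] := nilp2; have dimlt := dim_derived_lt_center dim7 nil decomp.
have [x [y xy]] : exists x y : g, br x y != 0.
  move/existsNP: nonab => [x /existsNP[y /eqP xy]]; by exists x, y.
have xyD := mem_derived x y.
have [d3|] := leqP 3 (\dim (derived g)).
  by apply: (coclosed_derived3 dim7 nil d3); lia.
rewrite ltnS leq_eqVlt => /orP[/eqP d2|d1].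
  by apply: (coclosed_derived2 dim7 nil d2); lia.
have lineE : <[br x y]>%VS = derived g.
  by apply/eqP; rewrite eqEdim -memvE xyD dim_vline xy -ltnS.
apply: (coclosed_derived1 dim7 nil xy) => [u v|].
  by apply/vlineP; rewrite lineE mem_derived.
by move: dimlt; rewrite -lineE dim_vline xy.
Qed.
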